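(* Let $\mathcal C$ be an $N$-dimensional asymptotic class and let $\mathcal D$ be a class of finite $L'$-structures uniformly parameter-interpreted in $\mathcal C$ by an interpretation $\mathcal I$ of arity $r$. Assume that $\mathcal I$ is quotient-trace reflecting, or more generally that it satisfies the profile-descent hypotheses (i) and (ii) of the context. Then $$L_{\rm vis}(\mathcal I)\mid L_Q,$$ and $L_{\rm vis}(\mathcal I)$ is the least asymptotic denominator of $\mathcal D$, i.e. the least $h\ge1$ such that $\mathcal D$ is an $h$-dimensional asymptotic class. Consequently, the visible denominators computed from any two such interpretations of the same target class $\mathcal D$ are equal.
   Context: Conventions. Languages $L,L'$ are countable first-order languages, possibly with finitely many sorts; function and constant symbols may be replaced by graph relations. All structures in the classes considered are finite, and $|M|$ is the total number of elements (summed over sorts). Uniform little-$o$. For a collection $\Phi$ (a ''cell'') of pairs $(M,\bar a)$, $f=o(g)$ uniformly on $\Phi$ means: for every $\varepsilon>0$ there is $Q$ with $|f(M,\bar a)|\le\varepsilon g(M,\bar a)$ for all $(M,\bar a)\in\Phi$ with $|M|>Q$. $N$-dimensional asymptotic class ($N\ge1$). A class $\mathcal C$ of finite $L$-structures such that for every $L$-formula $\varphi(x;\bar y)$ with a single object variable $x$ there are a finite set $D_\varphi\subseteq(\{0,\dots,N\}\times\mathbb R_{>0})\cup\{(0,0)\}$ and, for each $(d,\mu)\in D_\varphi$, a parameter-free $L$-formula $\theta_{d,\mu}(\bar y)$ such that in every $M\in\mathcal C$ the sets $\theta_{d,\mu}(M^{|\bar y|})$ partition $M^{|\bar y|}$,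 and, uniformly on the cell $\{(M,\bar a):M\models\theta_{d,\mu}(\bar a)\}$, $|\varphi(M;\bar a)|=\mu|M|^{d/N}+o(|M|^{d/N})$; for $(0,0)$ this means $|\varphi(M;\bar a)|=o(1)$. Uniform parameter-interpretation $\mathcal I$ of $\mathcal D$ in $\mathcal C$, of arity $r\ge1$: an injection $\alpha:\mathcal D\to\mathcal C$; an integer $s\ge0$; fixed $L$-formulas $\delta(\bar u;\bar z)$, $\epsilon(\bar u,\bar v;\bar z)$ with $|\bar u|=|\bar v|=r$, $|\bar z|=s$; for each relation symbol $R\in L'$ a fixed $L$-formula $R^{\mathcal I}$ on the appropriate number of $r$-tuples (and $\bar z$); and for each $A\in\mathcal D$ a tuple $\bar c_A\in\alpha(A)^s$ and an $L'$-isomorphism $\iota_A:A\to X_A/E_A$, where $X_A=\delta(\alpha(A)^r;\bar c_A)$ and $E_A$ is the equivalence relation on $X_A$ defined by $\epsilon(\bar u,\bar v;\bar c_A)$; the formulas $R^{\mathcal I}$ (evaluated at $\bar c_A$) are $E_A$-invariant on $X_A$ and induce the $L'$-structure on $X_A/E_A$. A representative of $a\in A$ is an element of the class $\iota_A(a)$. Quotient-trace reflecting: for every $m\ge0$ and every parameter-free $L$-formula $\rho(\bar v_1,\dots,\bar v_m;\bar z)$ (each $\bar v_i$ an $r$-tuple) such that, for every $A\in\mathcal D$, $\rho(\cdot;\bar c_A)$ is $E_A$-invariant in each $\bar v_i$ on $X_A^m$, there is a parameter-free $L'$-formula $\rho^{\downarrow}(y_1,\dots,y_m)$ such that for every $A\in\mathcal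 D$, all $a_1,\dots,a_m\in A$ and arbitrary representatives $\bar v_i\in X_A$ of $a_i$: $A\models\rho^{\downarrow}(a_1,\dots,a_m)\iff\alpha(A)\models\rho(\bar v_1,\dots,\bar v_m;\bar c_A)$. Quotient-universe partition and $L_Q$. There is a finite family of parameter-free $L$-formulas $\chi_{e,\lambda}(\bar z)$, indexed by pairs $(e,\lambda)\in(\{0,\dots,Nr\}\times\mathbb R_{>0})\cup\{(0,0)\}$, such that for each $A\in\mathcal D$ exactly one $\chi_{e,\lambda}(\bar c_A)$ holds in $M=\alpha(A)$, and uniformly on each cell $|A|=|X_A/E_A|=\lambda|M|^{e/N}+o(|M|^{e/N})$ (as $|M|\to\infty$). Fix such a partition. Let $\mathscr E_Q$ be the set of positive $e$ for which, for some $\lambda>0$, the structures $A\in\mathcal D$ with $\alpha(A)\models\chi_{e,\lambda}(\bar c_A)$ have unbounded cardinality. Then $L_Q=\operatorname{lcm}(\mathscr E_Q)$, with $\operatorname{lcm}(\varnothing)=1$. Ambient quotient-counting partition for an $L'$-formula $\varphi(x;y_1,\dots,y_m)$ with one object variable: finitely many parameter-free $L$-formulas $\theta_i(\bar v_1,\dots,\bar v_m;\bar z)$, $i\in I$, with labels $(d_i,\mu_i)\in(\{0,\dots,Nr\}\times\mathbb R_{>0})\cup\{(0,0)\}$, such that for each $A\in\mathcal D$ the formulas $\theta_i(\cdot;\bar c_A)$ partition $X_A^m$ and, uniformly over all $A\in\mathcal D$ and $\bar b\in A^m$ having a representative tuple $\bar v\in X_A^m$ with $\alpha(A)\models\theta_i(\bar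 v;\bar c_A)$, $|\varphi(A;\bar b)|=\mu_i|M|^{d_i/N}+o(|M|^{d_i/N})$, $M=\alpha(A)$ (meaning $o(1)$ for label $(0,0)$). (Such partitions always exist.) The profile of $\bar b\in A^m$ is the nonempty set $P\subseteq I$ of all $i$ such that some representative tuple of $\bar b$ satisfies $\theta_i(\cdot;\bar c_A)$ in $\alpha(A)$. Profile-descent hypotheses: (i) for each cell $\chi_{e,\lambda}$ there is a parameter-free $L'$-sentence true in $A$ iff $\alpha(A)\models\chi_{e,\lambda}(\bar c_A)$, for all $A\in\mathcal D$; (ii) for each $\varphi(x;\bar y)$ one can choose an ambient quotient-counting partition such that for each nonempty $P\subseteq I$ there is a parameter-free $L'$-formula defining, in every $A\in\mathcal D$, the set of $\bar b$ with profile $P$. (Quotient-trace reflection implies (i) and (ii).) Visible denominator. For each $\varphi$ fix such a partition (one as in (ii)). For a universe cell $(e,\lambda)$ and a profile $P$, consider the joint cell of all $(A,\bar b)$ with $\alpha(A)\models\chi_{e,\lambda}(\bar c_A)$ and $\bar b$ of profile $P$. If $|A|$ is unbounded on this joint cell then $e>0$ and all labels in $P$ coincide; if the common label is $(d,\mu)$ with $\mu>0$, the fraction $d/e$ is said to occur (one has $0\le d\le e$). Let $\Sigma_{\mathcal I}$ be the set of all fractions $d/e$ that occur in this way as $\varphi$ varies over all $L'$-formulas. Put $L_{\rm vis}(\mathcal I)=\operatorname{lcm}\{e/\gcd(d,e): d/e\in\Sigma_{\mathcal I}\}$, with $\operatorname{lcm}(\varnothing)=1$. *)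

(* Defs.v *)
(* Built on MathComp and MathComp-Analysis. *)
From HB Require Import structures.
From mathcomp Require Import all_boot all_order all_algebra.
From mathcomp Require Import boolp classical_sets functions fsbigop reals exp.
Set Implicit Arguments.
Unset Strict Implicit.
Unset Printing Implicit Defensive.
Import Order.TTheory GRing.Theory Num.Theory.
Local Open Scope classical_set_scope.
Local Open Scope ring_scope.

Record language := Language {
  srt : finType;
  rsym : countType;
  rarity : rsym -> nat;
  rdom : forall P : rsym, 'I_(rarity P) -> srt;
  fsym : countType;
  farity : fsym -> nat;
  fdom : forall f : fsym, 'I_(farity f) -> srt;
  fcod : fsym -> srt
}.

(* A finite many-sorted structure. Constants are the functions of arity 0;
   sorts may be empty. *)
Record structure (L : language) := Structure {
  carrier :> srt L -> finType;
  rel_of : forall P : rsym L, (forall i, carrier (rdom (P := P) i)) -> bool;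
  fun_of : forall f : fsym L,
    (forall i, carrier (fdom (f := f) i)) -> carrier (fcod f)
}.

Definition str_size (L : language) (M : structure L) : nat :=
  (\sum_(s : srt L) #|M s|)%N.

(* Terms and formulas are well-sorted by construction, over a context
   [c : V -> srt L] giving the sorts of the free variables, which are named
   by the elements of V. The variable bound by a quantifier is [None] in the
   extended context; likewise the object variable x of phi(x; y_1, .., y_m) is
   [None] and the y_i are the [Some i]. *)
Definition ctx_ext (L : language) (V : Type) (c : V -> srt L) (s : srt L) :
    option V -> srt L :=
  fun o => match o with Some v => c v | None => s end.

Inductive fterm (L : language) (V : Type) (c : V -> srt L) : srt L -> Type :=
| tvar (v : V) : fterm c (c v)
| tapp (f : fsym L) (t : forall i, fterm c (fdom (f := f) i)) : fterm c (fcod f).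

Inductive formula (L : language) (V : Type) (c : V -> srt L) : Type :=
| fbot : formula c
| feq (s : srt L) (t u : fterm c s) : formula c
| frel (P : rsym L) (t : forall i, fterm c (rdom (P := P) i)) : formula c
| fimp (p q : formula c) : formula c
| fall (s : srt L) (p : formula (ctx_ext c s)) : formula c.

Definition sentence (L : language) := formula (of_void (srt L)).

Definition env (L : language) (M : structure L) (V : Type)
  (c : V -> srt L) := forall v, M (c v).

Definition env0 (L : language) (M : structure L) :
    env M (of_void (srt L)) :=
  fun v => match v with end.

Definition env_ext (L : language) (M : structure L) (V : Type)
    (c : V -> srt L) (s : srt L) (e : env M c) (a : M s) :
    env M (ctx_ext c s) :=
  fun o => match o return M (ctx_ext c s o) with
           | Some v => e v
           | None => a
           end.

Fixpoint teval (L : language) (M : structure L) (V : Type) (c : V -> srt L)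
    (e : env M c) (s : srt L) (t : fterm c s) : M s :=
  match t in fterm _ s return M s with
  | tvar v => e v
  | tapp f t => fun_of (fun i => teval e (t i))
  end.

Fixpoint sat (L : language) (M : structure L) (V : Type) (c : V -> srt L)
    (p : formula c) : env M c -> bool :=
  match p with
  | fbot => fun=> false
  | feq s t u => fun e => teval e t == teval e u
  | frel P t => fun e => rel_of (fun i => teval e (t i))
  | fimp p q => fun e => sat p e ==> sat q e
  | fall s p => fun e => [forall a : M s, sat p (env_ext e a)]
  end.

(* |phi(M; b)| *)
Definition nb_sol (L : language) (M : structure L) (V : Type)
    (c : V -> srt L) (s : srt L) (p : formula (ctx_ext c s)) (b : env M c) : nat :=
  #|[pred a : M s | sat p (env_ext b a)]|.

Definition little_o (R : realType) (T : Type) (size : T -> nat)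
    (cell : T -> Prop) (f g : T -> R) : Prop :=
  forall eps : R, 0 < eps -> exists Q : nat, forall x : T,
    cell x -> (Q < size x)%N -> `|f x| <= eps * g x.

Definition label (R : realType) : Type := (nat * R)%type.

Definition valid_label (R : realType) (K : nat) (l : label R) : Prop :=
  ((l.1 <= K)%N /\ 0 < l.2) \/ l = (0%N, 0).

(* For the label (0, 0) this says f = o(1), since x `^ 0 = 1. *)
Definition asymptotic_to (R : realType) (N : nat) (T : Type) (size : T -> nat)
    (cell : T -> Prop) (f : T -> nat) (l : label R) : Prop :=
  little_o size cell
    (fun x => (f x)%:R - l.2 * (size x)%:R `^ (l.1%:R / N%:R))
    (fun x => (size x)%:R `^ (l.1%:R / N%:R)).

Definition asymptotic_class (R : realType) (L : language) (N : nat)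
    (C : structure L -> Prop) : Prop :=
  (0 < N)%N /\
  forall (s : srt L) (m : nat) (c : 'I_m -> srt L) (phi : formula (ctx_ext c s)),
  exists (D : seq (label R)) (theta : label R -> formula c),
    [/\ forall l, l \in D -> valid_label N l,
        forall M, C M -> forall b : env M c,
          exists! l, l \in D /\ sat (theta l) b
      & forall l, l \in D ->
          asymptotic_to N (fun x : {M : structure L & env M c} => str_size (tag x))
            (fun x => C (tag x) /\ sat (theta l) (tagged x))
            (fun x => nb_sol phi (tagged x)) l].

Definition least_asymptotic_denominator (R : realType) (L : language)
    (D : structure L -> Prop) (h : nat) : Prop :=
  asymptotic_class R h D /\
  forall k : nat, asymptotic_class R k D -> (h <= k)%N.

(* Context of the formulas rho((v_k)_(k : K); z): each v_k is an r-tuple of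
   variables standing for one element of sort [tau k] of the interpreted
   structure; [us t] gives the sorts of the tuples that represent elements of
   sort t, [zs] the sorts of the parameters z. *)
Definition block_ctx (L L' : language) (r n : nat)
    (us : srt L' -> 'I_r -> srt L) (zs : 'I_n -> srt L)
    (K : Type) (tau : K -> srt L') : (K * 'I_r) + 'I_n -> srt L :=
  fun x => match x with inl kj => us (tau kj.1) kj.2 | inr j => zs j end.

Definition block_env (L L' : language) (r n : nat)
    (us : srt L' -> 'I_r -> srt L) (zs : 'I_n -> srt L)
    (K : Type) (tau : K -> srt L') (M : structure L)
    (v : forall k, env M (us (tau k))) (z : env M zs) :
    env M (block_ctx us zs tau) :=
  fun x => match x return M (block_ctx us zs tau x) with
           | inl kj => v kj.1 kj.2
           | inr j => z j
           end.

(* The formulas of an interpretation of L' in L, of arity r. When L' has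
   several sorts there is one delta and one epsilon for each of them. A
   function symbol of L' is interpreted through its graph, the value being the
   block [None]. In [code_eps] the block [false] is u and [true] is v. *)
Record interp_code (L L' : language) (r : nat) := InterpCode {
  code_n : nat;
  code_zs : 'I_code_n -> srt L;
  code_us : srt L' -> 'I_r -> srt L;
  code_delta : forall t : srt L',
    formula (block_ctx code_us code_zs (fun _ : unit => t));
  code_eps : forall t : srt L',
    formula (block_ctx code_us code_zs (fun _ : bool => t));
  code_rel : forall P : rsym L',
    formula (block_ctx code_us code_zs (rdom (P := P)));
  code_fun : forall f : fsym L',
    formula (block_ctx code_us code_zs (ctx_ext (fdom (f := f)) (fcod f)))
}.

Arguments code_zs {L L' r} i.
Arguments code_us {L L' r} i.

Section Code.
Variables (L L' : language) (r : nat) (I : interp_code L L' r).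
Variables (M : structure L) (z : env M (code_zs I)).

Definition rtuple (t : srt L') : Type := env M (code_us I t).

Definition Xset (t : srt L') : set (rtuple t) :=
  [set u : rtuple t |
    sat (code_delta I t)
      (block_env (tau := fun _ => t) (fun _ : unit => u) z)].

Definition Erel (t : srt L') (u v : rtuple t) : Prop :=
  sat (code_eps I t)
    (block_env (tau := fun _ => t) (fun b : bool => if b then v else u) z).

(* X / E *)
Definition Xquo (t : srt L') : set (set (rtuple t)) :=
  [set c | exists2 u : rtuple t, Xset u & c = [set v | Xset v /\ Erel u v]].

Definition E_invariant (K : Type) (tau : K -> srt L')
    (rho : formula (block_ctx (code_us I) (code_zs I) tau)) : Prop :=
  forall v w : forall k, rtuple (tau k),
    (forall k, Xset (v k)) -> (forall k, Xset (w k)) ->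
    (forall k, Erel (v k) (w k)) ->
    sat rho (block_env v z) = sat rho (block_env w z).

End Code.

(* [iso_class] is the isomorphism of A onto X / E: it maps a to the set of its
   representatives. [interp_rel] and [interp_fun] quantify over all
   representatives: they say both that the formulas are E-invariant on X and
   that iso_class is an isomorphism onto the structure they induce on X / E. *)
Record interpretation (L L' : language) (C : structure L -> Prop)
    (D : structure L' -> Prop) (r : nat) := Interpretation {
  interp_arity : (0 < r)%N;
  code :> interp_code L L' r;
  alpha : {A : structure L' | D A} -> {M : structure L | C M};
  alpha_inj : injective alpha;
  param : forall A, env (sval (alpha A)) (code_zs code);
  interp_refl : forall A t u, Xset (param A) u -> Erel (t := t) (param A) u u;
  interp_sym : forall A t u v, Xset (param A) u -> Xset (param A) v ->
    Erel (t := t) (param A) u v -> Erel (param A) v u;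
  interp_trans : forall A t u v w,
    Xset (param A) u -> Xset (param A) v -> Xset (param A) w ->
    Erel (t := t) (param A) u v -> Erel (param A) v w -> Erel (param A) u w;
  iso_class : forall (A : {A : structure L' | D A}) t,
    sval A t -> set (rtuple code (sval (alpha A)) t);
  iso_class_bij : forall (A : {A : structure L' | D A}) t,
    set_bij [set: sval A t] (Xquo (param A) (t := t))
    (iso_class (A := A) (t := t));
  interp_rel : forall (A : {A : structure L' | D A}) (P : rsym L')
    (a : env (sval A) (rdom (P := P)))
    (v : forall i, rtuple code (sval (alpha A)) (rdom (P := P) i)),
    (forall i, iso_class (a i) (v i)) ->
    sat (code_rel code P) (block_env v (param A)) = rel_of a;
  interp_fun : forall (A : {A : structure L' | D A}) (f : fsym L')
    (a : env (sval A) (fdom (f := f))) (b : sval A (fcod f))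
    (v : forall k,
       rtuple code (sval (alpha A)) (ctx_ext (fdom (f := f)) (fcod f) k)),
    (forall k, iso_class (env_ext a b k) (v k)) ->
    sat (code_fun code f) (block_env v (param A)) = (fun_of a == b)
}.

Arguments alpha {L L' C D r} i.
Arguments param {L L' C D r} i.

(* A big operator over a set that is not finite would be the neutral element
   1; the sets [EQ] and the one defining [Lvis] are bounded, since the labels
   (e, lam) of a universe partition are finitely many. *)
Definition lcm_set (S : set nat) : nat := \big[lcmn/1%N]_(n \in S) n.

Section Visible.
Variables (R : realType) (N : nat).
Variables (L L' : language) (C : structure L -> Prop) (D : structure L' -> Prop).
Variables (r : nat) (I : interpretation C D r).

Notation member := {A : structure L' | D A}.
Notation us := (code_us I).
Notation zs := (code_zs I).

Definition host (A : member) : structure L := sval (alpha I A).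

Definition represents (A : member) (K : Type) (tau : K -> srt L')
    (v : forall k, rtuple I (host A) (tau k)) (a : env (sval A) tau) : Prop :=
  forall k, iso_class (a k) (v k).

Definition quotient_trace_reflecting : Prop :=
  forall (m : nat) (tau : 'I_m -> srt L') (rho : formula (block_ctx us zs tau)),
  (forall A : member, E_invariant (param I A) rho) ->
  exists rhod : formula tau, forall (A : member) (a : env (sval A) tau)
    (v : forall k, rtuple I (host A) (tau k)),
    represents v a -> (sat rhod a <-> sat rho (block_env v (param I A))).

Record universe_partition := UniversePartition {
  up_labels : seq (label R);
  chi : label R -> formula zs;
  up_valid : forall l, l \in up_labels -> valid_label (N * r) l;
  up_unique : forall A : member,
    exists! l, l \in up_labels /\ sat (chi l) (param I A);
  up_asymptotic : forall l, l \in up_labels ->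
    asymptotic_to N (fun A => str_size (host A))
      (fun A => sat (chi l) (param I A)) (fun A => str_size (sval A)) l
}.

Definition EQ (U : universe_partition) : set nat :=
  [set e | (0 < e)%N /\ exists lam : R,
     [/\ 0 < lam, (e, lam) \in up_labels U
       & forall Q : nat, exists A : member,
           sat (chi U (e, lam)) (param I A) /\ (Q < str_size (sval A))%N]].

Definition LQ (U : universe_partition) : nat := lcm_set (EQ U).

Record counting_partition (t : srt L') (m : nat) (tau : 'I_m -> srt L')
    (phi : formula (ctx_ext tau t)) := CountingPartition {
  cp_index : finType;
  cp_label : cp_index -> label R;
  cp_theta : cp_index -> formula (block_ctx us zs tau);
  cp_valid : forall i, valid_label (N * r) (cp_label i);
  cp_unique : forall (A : member) (v : forall k, rtuple I (host A) (tau k)),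
    (forall k, Xset (param I A) (v k)) ->
    exists! i, sat (cp_theta i) (block_env v (param I A));
  cp_asymptotic : forall i,
    asymptotic_to N
      (fun x : {A : member & env (sval A) tau} => str_size (host (tag x)))
      (fun x => exists2 v, represents v (tagged x)
         & sat (cp_theta i) (block_env v (param I (tag x))))
      (fun x => nb_sol phi (tagged x)) (cp_label i)
}.

Definition profile (t : srt L') (m : nat) (tau : 'I_m -> srt L')
    (phi : formula (ctx_ext tau t)) (Th : counting_partition phi)
    (A : member) (b : env (sval A) tau) : {set cp_index Th} :=
  finset (fun i => `[< exists2 v, represents v b
                       & sat (cp_theta i) (block_env v (param I A)) >]).

Definition profile_definable (t : srt L') (m : nat) (tau : 'I_m -> srt L')
    (phi : formula (ctx_ext tau t)) (Th : counting_partition phi) : Prop :=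
  forall P : {set cp_index Th}, P != finset.set0 ->
  exists psi : formula tau, forall (A : member) (b : env (sval A) tau),
    sat psi b <-> profile Th b = P.

Definition universe_descent (U : universe_partition) : Prop :=
  forall l, l \in up_labels U ->
  exists psi : sentence L', forall A : member,
    sat psi (env0 (sval A)) <-> sat (chi U l) (param I A).

Definition profile_descent : Prop :=
  forall (t : srt L') (m : nat) (tau : 'I_m -> srt L')
    (phi : formula (ctx_ext tau t)),
  exists Th : counting_partition phi, profile_definable Th.

Definition descent_hypothesis (U : universe_partition) : Prop :=
  quotient_trace_reflecting \/ (universe_descent U /\ profile_descent).

Record partition_choice := PartitionChoice {
  chosen : forall (t : srt L') (m : nat) (tau : 'I_m -> srt L')
    (phi : formula (ctx_ext tau t)), counting_partition phi;
  chosen_definable : forall (t : srt L') (m : nat) (tau : 'I_m -> srt L')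
    (phi : formula (ctx_ext tau t)), profile_definable (chosen phi)
}.

(* The fraction d/e occurs. That d <= e and 0 < e is then automatic. *)
Definition occurs (U : universe_partition) (Th : partition_choice)
    (d e : nat) : Prop :=
  exists (t : srt L') (m : nat) (tau : 'I_m -> srt L')
    (phi : formula (ctx_ext tau t)) (lam mu : R)
    (P : {set cp_index (chosen Th phi)}),
  [/\ (e, lam) \in up_labels U,
      P != finset.set0,
      forall Q : nat, exists (A : member) (b : env (sval A) tau),
        [/\ sat (chi U (e, lam)) (param I A), profile (chosen Th phi) b = P
          & (Q < str_size (sval A))%N],
      forall i, i \in P -> cp_label i = (d, mu)
    & 0 < mu].

Definition Lvis (U : universe_partition) (Th : partition_choice) : nat :=
  lcm_set [set n | exists d e : nat, occurs U Th d e /\ n = (e %/ gcdn d e)%N].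

End Visible.

(* Main.v *)
Require Import Defs.
From mathcomp Require Import all_boot all_order all_algebra.
From mathcomp Require Import boolp classical_sets functions fsbigop reals exp.
From mathcomp Require Import cardinality topology normedtype sequences.
Set Implicit Arguments.
Unset Strict Implicit.
Unset Printing Implicit Defensive.
Import Order.TTheory GRing.Theory Num.Theory numFieldNormedType.Exports.

(* The number of E-classes of a definable set X is the sum over u in X of the
   inverse of the size of the class of u. Functions that are, on each cell of a
   finite definable partition, either eventually zero or asymptotic to
   mu |M|^(d/N) with mu > 0 and d an integer are closed under sums, products,
   inverses and summation over a variable; hence all counts of classes are of
   this kind, which gives the ambient partitions. On a cell where
   |phi(A; b)| ~ mu |M|^(d/N) and |A| ~ lam |M|^(e/N) with |A| unbounded,
   eliminating |M| gives |phi(A; b)| ~ mu lam^(-d/e) |A|^(d/e). So h is an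
   asymptotic denominator as soon as every reduced denominator e/gcd(d, e)
   divides h, and conversely by uniqueness of the exponents. *)

(** * Definable relations *)

(** The class hypothesis counts solutions in one variable only. Sums over a variable remain
    tractable because, on a definable piece where the summand is uniformly equivalent to mu
    |M|^alpha, the sum is the number of terms times an average with the same growth. Iteration gives
    sums over r-tuples, and positive coefficients rule out cancellation. The cells so obtained need
    not be E-invariant: two representative tuples of the same b may lie in different cells, whence
    profiles. All labels of a profile describe the same count, so they agree on a cell of unbounded
    size, while a cell of bounded size imposes nothing. Descent supplies the definability of these
    cells in L'. The bound |A| <= c |M|^r caps the exponents by N r and makes |M| tend to infinity
    whenever |A| does, so that limits in |M| can be reread as limits in |A|. The converse gives more
    than minimality: [Lvis] divides every asymptotic denominator of D. *)

Section DependentEnvironments.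
Variables (S : eqType) (X : S -> Type).

(** The sorts of [v] and [t v] agree only through the proof [H], whence the cast. *)
Definition pull (V W : Type) (c : V -> S) (c' : W -> S) (t : V -> W)
    (H : forall v, c v = c' (t v)) (e : forall w, X (c' w)) :
  forall v, X (c v) :=
  fun v => ecast s (X s) (esym (H v)) (e (t v)).

Lemma pullE (V W : Type) (c : V -> S) (c' : W -> S) (t : V -> W)
    (H : forall v, c v = c' (t v)) (e : forall w, X (c' w)) v :
  Tagged X (pull H e v) = Tagged X (e (t v)).
Proof. by rewrite /pull; case: _ / (esym (H v)). Qed.

(** Sorts have decidable equality, so equality proofs between them are unique. Casts can then be
    removed by comparing tagged values. *)
Lemma Tagged_inj (s : S) : injective (@Tagged S s X).
Proof.
move=> x y /(congr1 (tagged_as (Tagged X x))).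
by rewrite !tagged_asE.
Qed.

Lemma pull_eq (V W : Type) (c : V -> S) (c' : W -> S) (t : V -> W)
    (H : forall v, c v = c' (t v)) (e : forall w, X (c' w))
    (e2 : forall v, X (c v)) :
  (forall v, Tagged X (e (t v)) = Tagged X (e2 v)) -> pull H e = e2.
Proof.
by move=> h; apply: functional_extensionality_dep => v; apply: Tagged_inj;
  rewrite pullE.
Qed.

End DependentEnvironments.

Section Contexts.
Variable L : language.

Definition ctx_sum (V W : Type) (c : V -> srt L) (d : W -> srt L) :
    V + W -> srt L :=
  fun x => match x with inl v => c v | inr w => d w end.

(** The family [X] is left free because the same extension serves for elements of a structure and
    for the r-tuples that represent elements of an interpreted one. *)
Definition ext_env (X : srt L -> Type) (V : Type) (c : V -> srt L) (s : srt L)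
    (e : forall v, X (c v)) (a : X s) : forall o, X (ctx_ext c s o) :=
  fun o => match o return X (ctx_ext c s o) with
           | Some v => e v | None => a end.

Definition sum_env (X : srt L -> Type) (V W : Type) (c : V -> srt L)
    (d : W -> srt L) (e : forall v, X (c v)) (u : forall w, X (d w)) :
    forall x, X (ctx_sum c d x) :=
  fun x => match x return X (ctx_sum c d x) with
           | inl v => e v | inr w => u w end.

End Contexts.

(* The induction step trades the first block variable for one more free
   variable, so the statement quantifies over all contexts. *)
Section Aggregate.
Variables (L : language) (U : Type) (car : U -> srt L -> finType).
Variables (T : Type) (idx : T) (op : Monoid.com_law idx).
Variable K : Type -> Prop.
Variable Q : forall (V : Type) (c : V -> srt L),
  (forall M, (forall v, car M (c v)) -> T) -> Prop.
Hypothesis K_option : forall V, K V -> K (option V).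
Hypothesis Q_pull : forall (V W : Type) (c : V -> srt L) (c' : W -> srt L)
    (t : V -> W) (H : forall v, c v = c' (t v)) f,
  Q f -> Q (fun M e => f M (pull (X := car M) H e)).
Hypothesis Q_step : forall (V : Type) (c : V -> srt L) (s : srt L)
    (f : forall M, (forall o, car M (ctx_ext c s o)) -> T),
  K V -> Q f ->
  Q (fun M e => \big[op/idx]_(a : car M s) f M (ext_env (X := car M) e a)).

(** Used with [orb] for quantifiers over a block, of elements or of tuples, and with [+%R] for sums
    over a block. [K] carries the finiteness of the set of variables, which counting requires. *)
Lemma aggregate_block (r : nat) (V : Type) (c : V -> srt L)
    (d : 'I_r -> srt L) (f : forall M, (forall x, car M (ctx_sum c d x)) -> T) :
  K V -> Q f ->
  Q (fun M e => \big[op/idx]_(u : {dffun forall i, car M (d i)})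
                  f M (sum_env (X := car M) e u)).
Proof.
elim: r V c d f => [|r IH] V c d f KV Qf.
  pose t (x : V + 'I_0) : V :=
    match x with inl v => v | inr i => False_rect V (notF (ltn_ord i)) end.
  have H x : ctx_sum c d x = c (t x) by case: x => [//|[]].
  have := Q_pull H Qf.
  congr Q; apply: functional_extensionality_dep => M; apply/funext => e.
  have u0 : {dffun forall i : 'I_0, car M (d i)} by apply: finfun => -[].
  rewrite (big_pred1 u0); last by move=> u; apply/esym/eqP/ffunP => -[].
  by congr f; apply: pull_eq => -[//|[]].
pose d' (i : 'I_r) := d (lift ord0 i).
pose t (x : V + 'I_r.+1) : option V + 'I_r :=
  match x with
  | inl v => inl (Some v)
  | inr i => if unlift ord0 i is Some j then inr j else inl None
  end.
have H x : ctx_sum c d x = ctx_sum (ctx_ext c (d ord0)) d' (t x).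
  by case: x => [//|i] /=; case: unliftP => [j ->|->].
have := Q_step KV (IH _ _ _ _ (K_option KV) (Q_pull H Qf)).
congr Q; apply: functional_extensionality_dep => M; apply/funext => e.
have Hd i : d i = ctx_ext d' (d ord0) (unlift ord0 i).
  by case: unliftP => [j ->|->].
pose phi (p : car M (d ord0) * {dffun forall i, car M (d' i)}) :
    {dffun forall i, car M (d i)} :=
  finfun (pull Hd (ext_env (X := car M) (p.2 : forall i, car M (d' i)) p.1)).
have phiE p i : Tagged (car M) (phi p i) = Tagged (car M)
    (ext_env (X := car M) (p.2 : forall i, car M (d' i)) p.1 (unlift ord0 i)).
  by rewrite ffunE pullE.
have phi_bij : bijective phi.
  exists (fun u : {dffun forall i, car M (d i)} =>
    (u ord0, finfun (fun i => u (lift ord0 i)) :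
               {dffun forall i, car M (d' i)})).
    case=> a h; congr pair.
      by apply: (@Tagged_inj _ (car M)); rewrite phiE unlift_none.
    apply/ffunP => i; rewrite ffunE; apply: (@Tagged_inj _ (car M)).
    by rewrite phiE liftK.
  move=> u; apply/ffunP => i; apply: (@Tagged_inj _ (car M)); rewrite phiE.
  by case: unliftP => [j ->|->] //=; congr Tagged; apply: ffunE.
rewrite [RHS](reindex phi) /=; last exact: onW_bij.
rewrite -(pair_big xpredT xpredT (fun a h => f M (sum_env e (phi (a, h))))) /=.
apply: eq_bigr => a _; apply: eq_bigr => h _; congr f.
apply: pull_eq => -[v|i] //=; rewrite phiE /=.
by case: (unliftP ord0 i).
Qed.

End Aggregate.

Local Notation env_pull M H e :=
  (pull (S := srt _) (X := fun s => carrier M s) H e).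

Section Definability.
Variables (L : language) (C : structure L -> Prop).

(** Taking a predicate [C] on structures as index lets one calculus serve both the ambient class and
    the target class. *)
Definition definable (V : Type) (c : V -> srt L)
    (f : forall M : {M | C M}, env (sval M) c -> bool) : Prop :=
  exists p : formula c, forall M e, sat p e = f M e.

Lemma fterm_pull (V W : Type) (c : V -> srt L) (c' : W -> srt L) (t : V -> W)
    (H : forall v, c v = c' (t v)) (s : srt L) (x : fterm c s) :
  exists y : fterm c' s, forall (M : structure L) (e : env M c'),
    teval e y = teval (env_pull M H e) x.
Proof.
elim: x => [v|f x IH].
  exists (ecast s (fterm c' s) (esym (H v)) (tvar c' (t v))) => M e.
  by rewrite /= /pull; case: _ / (esym (H v)).
exists (tapp (fun i => sval (cid (IH i)))) => M e /=.
by congr fun_of; apply: functional_extensionality_dep => i; case: cid.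
Qed.

Lemma formula_pull (V W : Type) (c : V -> srt L) (c' : W -> srt L) (t : V -> W)
    (H : forall v, c v = c' (t v)) (p : formula c) :
  exists q : formula c', forall (M : structure L) (e : env M c'),
    sat q e = sat p (env_pull M H e).
Proof.
elim: p W c' t H => {V c} [V c|V c s x y|V c P x|V c p IHp q IHq|V c s p IH]
  W c' t H.
- by exists (fbot _).
- have [x' hx] := fterm_pull H x; have [y' hy] := fterm_pull H y.
  by exists (feq x' y') => M e /=; rewrite hx hy.
- exists (Defs.frel (fun i => sval (cid (fterm_pull H (x i))))) => M e /=.
  by congr rel_of; apply: functional_extensionality_dep => i; case: cid.
- have [p' hp] := IHp _ _ _ H; have [q' hq] := IHq _ _ _ H.
  by exists (fimp p' q') => M e /=; rewrite hp hq.
- pose Ho o : ctx_ext c s o = ctx_ext c' s (omap t o) :=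
    match o with Some v => H v | None => erefl end.
  have [q hq] := IH _ _ _ Ho.
  exists (fall q) => M e /=; apply: eq_forallb => a; rewrite hq; congr sat.
  by apply: pull_eq => -[v|] //=; rewrite pullE.
Qed.

Lemma definable_pull (V W : Type) (c : V -> srt L) (c' : W -> srt L)
    (t : V -> W) (H : forall v, c v = c' (t v)) f :
  definable f ->
  definable (fun M (e : env (sval M) c') => f M (env_pull (sval M) H e)).
Proof.
by case=> p hp; have [q hq] := formula_pull H p; exists q => M e;
  rewrite hq hp.
Qed.

Variables (V : Type) (c : V -> srt L).
Implicit Types f g : forall M : {M | C M}, env (sval M) c -> bool.

Lemma definable_sat (p : formula c) :
  definable (fun M (e : env (sval M) c) => sat p e).
Proof. by exists p. Qed.

Lemma definable_ext f g :
  (forall M e, f M e = g M e) -> definable f -> definable g.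
Proof. by move=> fg [p hp]; exists p => M e; rewrite hp. Qed.

Lemma definable_imp f g :
  definable f -> definable g -> definable (fun M e => f M e ==> g M e).
Proof. by move=> [p hp] [q hq]; exists (fimp p q) => M e /=; rewrite hp hq. Qed.

Lemma definable_false : definable (fun M (e : env (sval M) c) => false).
Proof. by exists (fbot c). Qed.

Lemma definable_neg f : definable f -> definable (fun M e => ~~ f M e).
Proof.
move=> df; apply: definable_ext (definable_imp df definable_false) => M e.
by rewrite implybF.
Qed.

Lemma definable_or f g :
  definable f -> definable g -> definable (fun M e => f M e || g M e).
Proof.
move=> df dg; apply: definable_ext (definable_imp (definable_neg df) dg) => M e.
by rewrite implyNb.
Qed.

Lemma definable_and f g :
  definable f -> definable g -> definable (fun M e => f M e && g M e).
Proof.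
move=> df dg; apply: definable_ext
  (definable_neg (definable_or (definable_neg df) (definable_neg dg))) => M e.
by rewrite negb_or !negbK.
Qed.

Lemma definable_const b : definable (fun M (e : env (sval M) c) => b).
Proof.
case: b; last exact: definable_false.
by apply: definable_ext (definable_neg definable_false).
Qed.

Lemma definable_exists (J : finType)
    (F : J -> forall M : {M | C M}, env (sval M) c -> bool) :
  (forall j, definable (F j)) -> definable (fun M e => [exists j, F j M e]).
Proof.
move=> dF.
suff h (s : seq J) : definable (fun M e => has (fun j => F j M e) s).
  apply: definable_ext (h (enum J)) => M e.
  apply/hasP/existsP => [[j _ ?]|[j ?]]; exists j => //; exact: mem_enum.
elim: s => [|j s IH]; first exact: definable_false.
by apply: definable_or.
Qed.

Lemma definable_forall (J : finType)
    (F : J -> forall M : {M | C M}, env (sval M) c -> bool) :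
  (forall j, definable (F j)) -> definable (fun M e => [forall j, F j M e]).
Proof.
move=> dF.
apply: (@definable_ext (fun M e => ~~ [exists j, ~~ F j M e])) => [M e|].
  by rewrite negb_exists; apply: eq_forallb => j; rewrite negbK.
by apply/definable_neg/definable_exists => j; apply: definable_neg.
Qed.

End Definability.

Lemma definable_ex1 (L : language) (C : structure L -> Prop) (V : Type)
    (c : V -> srt L) (s : srt L)
    (f : forall M : {M | C M}, env (sval M) (ctx_ext c s) -> bool) :
  definable f ->
  definable (fun M (e : env (sval M) c) => [exists a, f M (env_ext e a)]).
Proof.
move=> df; have [p hp] := definable_neg df.
apply: (@definable_ext _ _ _ _
  (fun M (e : env (sval M) c) => ~~ [forall a, ~~ f M (env_ext e a)])).
  by move=> M e; rewrite negb_forall; apply: eq_existsb => a; rewrite negbK.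
by apply: definable_neg; exists (fall p) => M e /=; apply: eq_forallb => a.
Qed.

Lemma definable_ex_block (L : language) (C : structure L -> Prop) (r : nat)
    (V : Type) (c : V -> srt L) (d : 'I_r -> srt L)
    (f : forall M : {M | C M}, env (sval M) (ctx_sum c d) -> bool) :
  definable f ->
  definable (fun M (e : env (sval M) c) =>
    [exists u : {dffun forall i, sval M (d i)},
       f M (sum_env (X := fun s => carrier (sval M) s) e u)]).
Proof.
move=> df.
have := @aggregate_block L {M | C M} (fun M => carrier (sval M)) bool false
  orb (fun _ => True) (fun V c f => @definable L C V c f).
move=> /(_ (fun _ => id)) /(_ _ _ r V c d f I df) h.
apply: definable_ext (h _ _).
- by move=> M e; rewrite big_orE.
- by move=> *; apply: definable_pull.
move=> V' c' s g _ dg; apply: definable_ext (definable_ex1 dg) => M e.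
by rewrite big_orE.
Qed.

(** * Growth rates *)

(* Points of the classes under study range over a type too large for [set T] to
   be formed, so convergence on them is defined here, and the limit theorems of
   MathComp-Analysis are applied to image filters on [R] and [R * R]. *)
Record eventuality (T : Type) (F : (T -> Prop) -> Prop) : Prop := Eventuality {
  ev_all : F (fun=> True);
  ev_and : forall P Q, F P -> F Q -> F (fun x => P x /\ Q x);
  ev_sub : forall P Q : T -> Prop, (forall x, P x -> Q x) -> F P -> F Q
}.

Section Growth.
Local Open Scope classical_set_scope.
Local Open Scope ring_scope.
Variables (R : realType) (T : Type) (F : (T -> Prop) -> Prop).
Hypothesis FF : eventuality F.
Variable s : T -> R.
Hypothesis s_oo : forall A : R, F (fun x => A < s x).
Implicit Types (f g : T -> R) (a b mu nu : R).

Definition tends f mu : Prop :=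
  forall e, 0 < e -> F (fun x => `|mu - f x| <= e).

(** The value [mu = 0] is allowed and expresses f = o(s^a). *)
Definition rate f a mu : Prop := tends (fun x => f x / s x `^ a) mu.

(** Properness of the filter. For the filters [large] below it amounts to unboundedness of the
    cell. *)
Definition consistent : Prop := forall P, F P -> exists x, P x.

Lemma ev_true (P : T -> Prop) : (forall x, P x) -> F P.
Proof. by move=> hP; apply: ev_sub (ev_all FF). Qed.

Lemma ev_sub2 (P Q S : T -> Prop) : (forall x, P x -> Q x -> S x) ->
  F P -> F Q -> F S.
Proof.
by move=> h FP FQ; apply: ev_sub (ev_and FF FP FQ) => // x []; exact: h.
Qed.

Definition image_filter (U : Type) (h : T -> U) : set_system U :=
  fun A => F (fun x => A (h x)).

Lemma image_filterP (U : Type) (h : T -> U) : Filter (image_filter h).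
Proof.
rewrite /image_filter; split; first exact: ev_true.
- by move=> A B; exact: (ev_and FF).
- by move=> A B AB; apply: (ev_sub FF) => x /AB.
Qed.

Lemma tendsP f mu : tends f mu <-> image_filter f --> mu.
Proof.
have [E1 E2] := @cvgrPdist_le R R^o R (image_filter f) (image_filterP f) id mu.
by split=> [h|h e e0]; [exact: E2|exact: E1].
Qed.

Lemma tends_cst mu : tends (fun=> mu) mu.
Proof. by move=> e e0; apply: ev_true => x; rewrite subrr normr0 ltW. Qed.

Lemma tends_ext f g mu : F (fun x => f x = g x) -> tends f mu -> tends g mu.
Proof. by move=> fg h e e0; apply: ev_sub2 fg (h e e0) => x ->. Qed.

Lemma tends_pair f g mu nu (op : R * R -> R) : tends f mu -> tends g nu ->
  (forall G : set_system (R * R), Filter G ->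
    p.1 @[p --> G] --> mu -> p.2 @[p --> G] --> nu ->
    op p @[p --> G] --> op (mu, nu)) ->
  tends (fun x => op (f x, g x)) (op (mu, nu)).
Proof.
move=> /tendsP fmu /tendsP gnu h; apply/tendsP.
exact: (h _ (image_filterP (fun x => (f x, g x)))).
Qed.

Lemma tendsM f g mu nu : tends f mu -> tends g nu ->
  tends (fun x => f x * g x) (mu * nu).
Proof.
move=> h k; apply: (tends_pair (op := fun p => p.1 * p.2) h k) => G FG.
exact: cvgM.
Qed.

Lemma tendsD f g mu nu : tends f mu -> tends g nu ->
  tends (fun x => f x + g x) (mu + nu).
Proof.
move=> h k; apply: (tends_pair (op := fun p => p.1 + p.2) h k) => G FG.
exact: cvgD.
Qed.

Lemma tendsV f mu : mu != 0 -> tends f mu -> tends (fun x => (f x)^-1) mu^-1.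
Proof.
move=> mu0 h; apply: (tends_pair (op := fun p => p.1^-1) h h) => G FG + _.
exact: cvgV.
Qed.

Lemma tends_gt f a mu : a < mu -> tends f mu -> F (fun x => a < f x).
Proof.
move=> amu /tendsP h; have G := image_filterP f.
exact: (@cvgr_gt R R _ G id mu h _ amu).
Qed.

Lemma tends_lt f a mu : mu < a -> tends f mu -> F (fun x => f x < a).
Proof.
move=> amu /tendsP h; have G := image_filterP f.
exact: (@cvgr_lt R R _ G id mu h _ amu).
Qed.

Lemma tends_unique f mu nu : consistent -> tends f mu -> tends f nu -> mu = nu.
Proof.
move=> cF /tendsP h /tendsP k.
have G : ProperFilter (image_filter f).
  apply: Build_ProperFilter_ex (image_filterP f) => A /cF[x fx].
  by exists (f x).
by apply: cvg_unique h k.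
Qed.

Lemma tends_powR f mu b : 0 < mu -> tends f mu ->
  tends (fun x => f x `^ b) (mu `^ b).
Proof.
move=> mu0 h; have fpos := tends_gt mu0 h.
(* [powR] treats the base 0 apart; as [f] is eventually positive, it can be replaced there by exp(b
   ln f), which is continuous. *)
rewrite /powR (gt_eqF mu0).
apply: (@tends_ext (fun x => expR (b * ln (f x)))).
  by apply: (ev_sub FF) fpos => x fx; rewrite gt_eqF.
apply: (tends_pair (op := fun p => expR (b * ln p.1)) h h) => G FG hf _.
apply: continuous_cvg; first exact: continuous_expR.
by apply: cvgMr; apply: continuous_cvg => //; exact: continuous_ln.
Qed.

Lemma ev_s_gt0 : F (fun x => 0 < s x).
Proof. exact: s_oo. Qed.

Lemma rate_ext f g a mu : F (fun x => f x = g x) -> rate f a mu -> rate g a mu.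
Proof. by move=> fg; apply: tends_ext; apply: (ev_sub FF) fg => x ->. Qed.

Lemma pow_tends0 a : a < 0 -> tends (fun x => s x `^ a) 0.
Proof.
move=> a0 e e0.
(* The threshold solves s^a = e; since a < 0, a larger s makes s^a smaller. *)
have A0 : 0 < e `^ a^-1 by exact: powR_gt0.
apply: (ev_sub FF) (s_oo (e `^ a^-1)) => x sx.
rewrite sub0r normrN ger0_norm ?powR_ge0//.
have s0 : 0 < s x by rewrite (lt_trans A0).
rewrite -[leLHS]invrK -powRN -[leRHS]invrK lef_pV2 ?posrE ?invr_gt0 ?powR_gt0//.
have -> : e^-1 = (e `^ a^-1) `^ (- a).
  by rewrite -powRrM mulrN mulVf ?lt_eqF// powRN powRr1// ltW.
by rewrite ltW// gt0_ltr_powR ?oppr_gt0// nnegrE ltW.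
Qed.

Lemma rateM f g a b mu nu : rate f a mu -> rate g b nu ->
  rate (fun x => f x * g x) (a + b) (mu * nu).
Proof.
move=> fa gb; apply: tends_ext (tendsM fa gb).
apply: (ev_sub FF) ev_s_gt0 => x sx.
by rewrite powRD ?(gt_eqF sx) ?implybT// invfM mulrACA.
Qed.

Lemma rateV f a mu : mu != 0 -> rate f a mu ->
  rate (fun x => (f x)^-1) (- a) mu^-1.
Proof.
move=> mu0 fa; apply: tends_ext (tendsV mu0 fa); apply: ev_true => x.
by rewrite powRN invfM.
Qed.

Lemma rateD f g a mu nu : rate f a mu -> rate g a nu ->
  rate (fun x => f x + g x) a (mu + nu).
Proof.
move=> fa gb; apply: tends_ext (tendsD fa gb); apply: ev_true => x.
by rewrite mulrDl.
Qed.

Lemma rate_pow a : rate (fun x => s x `^ a) a 1.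
Proof.
apply: tends_ext (tends_cst 1); apply: (ev_sub FF) ev_s_gt0 => x sx.
by rewrite divff// gt_eqF// powR_gt0.
Qed.

Lemma rate_cst mu : rate (fun=> mu) 0 mu.
Proof.
by apply: tends_ext (tends_cst mu); apply: ev_true => x; rewrite powRr0 divr1.
Qed.

Lemma rate_lt f a b mu : a < b -> rate f a mu -> rate f b 0.
Proof.
move=> ab fa; rewrite -(mulr0 mu).
have h : tends (fun x => s x `^ (a - b)) 0.
  by apply: pow_tends0; rewrite subr_lt0.
apply: tends_ext (tendsM fa h); apply: (ev_sub FF) ev_s_gt0 => x sx.
by rewrite powRB ?(gt_eqF sx) ?implybT//= mulrA mulfVK// gt_eqF// powR_gt0.
Qed.

Lemma rate_gt0 f a mu : 0 < mu -> rate f a mu -> F (fun x => 0 < f x).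
Proof.
move=> mu0 fa; apply: ev_sub2 ev_s_gt0 (tends_gt mu0 fa) => x sx.
by rewrite pmulr_lgt0 ?invr_gt0 ?powR_gt0.
Qed.

(** If b < a, then g = o(s^a) while f eventually exceeds (mu / 2) s^a, against f <= g. Consistency
    provides a point where all three hold. *)
Lemma rate_le f g a b mu nu : consistent -> 0 < mu ->
  F (fun x => f x <= g x) -> rate f a mu -> rate g b nu -> a <= b.
Proof.
move=> cF mu0 fg fa gb; rewrite leNgt; apply/negP => ba.
have ga := rate_lt ba gb.
have mu2 : mu / 2 < mu by rewrite ltr_pdivrMr// mulr_natr mulr2n ltrDl.
have mu20 : 0 < mu / 2 by rewrite divr_gt0.
have [x [[k1 k2] k3]] :=
  cF _ (ev_and FF (ev_and FF (tends_gt mu2 fa) (tends_lt mu20 ga)) fg).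
have : f x / s x `^ a <= g x / s x `^ a.
  by rewrite ler_wpM2r// invr_ge0 powR_ge0.
by rewrite leNgt (lt_trans k2 k1).
Qed.

Lemma rate_unique f a b mu nu : consistent -> 0 < mu -> 0 < nu ->
  rate f a mu -> rate f b nu -> a = b /\ mu = nu.
Proof.
move=> cF mu0 nu0 fa fb.
have ff : F (fun x => f x <= f x) by exact: ev_true.
have ab : a = b.
  by apply/eqP; rewrite eq_le !(rate_le _ _ ff fa fb, rate_le _ _ ff fb fa).
by split=> //; subst b; apply: tends_unique fa fb.
Qed.

(** Separates the label (0, 0) from labels with a positive coefficient: f -> 0 forces f / s^a -> 0
    for every a >= 0. *)
Lemma rate0_absurd f a mu : consistent -> 0 <= a -> 0 < mu ->
  rate f 0 0 -> rate f a mu -> False.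
Proof.
move=> cF a0 mu0 f0 fa.
suff fa0 : rate f a 0.
  by move: mu0; rewrite (tends_unique cF fa fa0) ltxx.
by move: a0; rewrite le_eqVlt => /predU1P[<-//|a0]; exact: rate_lt f0.
Qed.

(** In the quotient of f / s^a by (g / s^b)^(a/b) the powers of s cancel. This is how the size of
    the host is eliminated in favour of that of the target structure. *)
Lemma rate_change f g a b mu nu : 0 < b -> 0 < nu -> rate f a mu ->
  rate g b nu ->
  tends (fun x => f x / g x `^ (a / b)) (mu / nu `^ (a / b)).
Proof.
move=> b0 nu0 fa gb.
have n0 : nu `^ (a / b) != 0 by rewrite gt_eqF ?powR_gt0.
apply: tends_ext (tendsM fa (tendsV n0 (tends_powR (a / b) nu0 gb))).
apply: ev_sub2 ev_s_gt0 (rate_gt0 nu0 gb) => x sx gx.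
have -> : (g x / s x `^ b) `^ (a / b) = g x `^ (a / b) / s x `^ a.
  rewrite powRM ?ltW ?invr_gt0 ?powR_gt0//; congr (_ * _).
  rewrite -(powRN (s x) b) -powRrM mulNr (mulrC b) divfK ?gt_eqF//.
  by rewrite powRN.
by rewrite invfM invrK mulrA mulrAC divfK// gt_eqF// powR_gt0.
Qed.

(** The first alternative is exact vanishing and not f = o(1): the inverse of a mere little-o would
    be uncontrolled, whereas 0^-1 = 0 keeps this alternative stable under inversion. *)
Definition good (N : nat) f : Prop :=
  F (fun x => f x = 0) \/
  exists (d : int) (mu : R), 0 < mu /\ rate f (d%:~R / N%:R) mu.

Lemma good_ext N f g : F (fun x => f x = g x) -> good N f -> good N g.
Proof.
move=> fg [f0|[d [mu [mu0 fd]]]]; [left|right].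
  by apply: ev_sub2 fg f0 => x ->.
by exists d, mu; split=> //; exact: rate_ext fd.
Qed.

Lemma goodM N f g : good N f -> good N g -> good N (fun x => f x * g x).
Proof.
move=> [f0 _|[d [mu [mu0 fd]]]].
  by left; apply: (ev_sub FF) f0 => x ->; rewrite mul0r.
move=> [g0|[e [nu [nu0 ge]]]].
  by left; apply: (ev_sub FF) g0 => x ->; rewrite mulr0.
right; exists (d + e), (mu * nu); split; first exact: mulr_gt0.
by rewrite intrD mulrDl; exact: rateM.
Qed.

Lemma goodV N f : good N f -> good N (fun x => (f x)^-1).
Proof.
move=> [f0|[d [mu [mu0 fd]]]].
  by left; apply: (ev_sub FF) f0 => x ->; rewrite invr0.
right; exists (- d), mu^-1; split; first by rewrite invr_gt0.
by rewrite intrN mulNr; apply: rateV => //; rewrite gt_eqF.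
Qed.

(** Both coefficients are positive, so nothing cancels: the larger exponent dominates, and equal
    exponents add their coefficients. *)
Lemma goodD N f g : (0 < N)%N -> good N f -> good N g ->
  good N (fun x => f x + g x).
Proof.
move=> N0 gf gg; case: (gf) => [f0|[d [mu [mu0 fd]]]].
  by apply: good_ext gg; apply: (ev_sub FF) f0 => x ->; rewrite add0r.
case: (gg) => [g0|[e [nu [nu0 ge]]]].
  by apply: good_ext gf; apply: (ev_sub FF) g0 => x ->; rewrite addr0.
have lt_rate (i j : int) : i < j -> i%:~R / N%:R < j%:~R / N%:R :> R.
  by move=> ij; rewrite ltr_pM2r ?invr_gt0 ?ltr0n// ltr_int.
right; have [de|ed|de] := ltgtP d e.
- by exists e, nu; split=> //; rewrite -[nu]add0r;
    apply: rateD => //; apply: rate_lt fd; exact: lt_rate.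
- by exists d, mu; split=> //; rewrite -[mu]addr0;
    apply: rateD => //; apply: rate_lt ge; exact: lt_rate.
- by exists d, (mu + nu); split; [exact: addr_gt0|apply: rateD; rewrite // de].
Qed.

Lemma good_cst N (a : R) : 0 <= a -> good N (fun=> a).
Proof.
rewrite le_eqVlt => /predU1P[<-|a0]; first by left; exact: ev_true.
by right; exists 0, a; split=> //; rewrite mulr0z mul0r; exact: rate_cst.
Qed.

End Growth.

(** * Sizes tending to infinity inside a cell *)

Section Large.
Local Open Scope ring_scope.
Variables (R : realType) (T : Type) (size : T -> nat).
Implicit Types (cell : T -> Prop).

Definition large cell : (T -> Prop) -> Prop :=
  fun A => exists Q : nat, forall x, cell x -> (Q < size x)%N -> A x.

Lemma largeP cell : eventuality (large cell).
Proof.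
split; first by exists 0%N.
- move=> A B [Q hA] [Q' hB]; exists (maxn Q Q') => x cx.
  by rewrite gtn_max => /andP[? ?]; split; [exact: hA|exact: hB].
- by move=> A B AB [Q hA]; exists Q => x cx Qx; apply/AB/hA.
Qed.

Definition unbounded cell := forall Q : nat, exists2 x, cell x & (Q < size x)%N.

Lemma large_consistent cell : unbounded cell -> consistent (large cell).
Proof. by move=> uc A [Q hA]; have [x cx Qx] := uc Q; exists x; exact: hA. Qed.

Lemma bounded_cell cell : ~ unbounded cell ->
  exists Q, forall x, cell x -> (size x <= Q)%N.
Proof.
move=> /existsNP[Q hQ]; exists Q => x cx; rewrite leqNgt; apply/negP => Qx.
by apply: hQ; exists x.
Qed.

Lemma large_oo cell (A : R) : large cell (fun x => A < (size x)%:R).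
Proof.
exists (Num.bound `|A|) => x _ hx.
rewrite (le_lt_trans (ler_norm A))// (lt_trans (archi_boundP (normr_ge0 A)))//.
by rewrite ltr_nat.
Qed.

Lemma large_sub cell cell' (A : T -> Prop) : (forall x, cell x -> cell' x) ->
  large cell' A -> large cell A.
Proof. by move=> cc [Q h]; exists Q => x /cc; exact: h. Qed.

Lemma asymptotic_rate N cell (f : T -> nat) (l : label R) :
  asymptotic_to N size cell f l <->
  rate (large cell) (fun x => (size x)%:R) (fun x => (f x)%:R)
    (l.1%:R / N%:R) l.2.
Proof.
have pw a : forall x : T, (0 < size x)%N -> 0 < (size x)%:R `^ a :> R.
  by move=> x x0; rewrite powR_gt0// ltr0n.
split=> [h e e0|h e e0]; have [Q hQ] := h e e0; exists Q => x cx Qx.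
  have px : 0 < (size x)%:R `^ (l.1%:R / N%:R) :> R by apply: pw; case: size Qx.
  rewrite distrC -[X in `|_ - X|](mulfK (lt0r_neq0 px)) -mulrBl normrM.
  rewrite [X in _ * X]gtr0_norm ?invr_gt0// ler_pdivrMr//.
  exact: hQ.
have px : 0 < (size x)%:R `^ (l.1%:R / N%:R) :> R by apply: pw; case: size Qx.
have := hQ x cx Qx; rewrite /= distrC.
rewrite -[X in `|_ - X|](mulfK (lt0r_neq0 px)) -mulrBl normrM.
by rewrite [X in _ * X]gtr0_norm ?invr_gt0// ler_pdivrMr.
Qed.

(** Little-o only constrains sizes beyond some Q, and Q may be taken above the bound: every label
    fits. *)
Lemma asymptotic_bounded N cell (f : T -> nat) (l : label R) :
  ~ unbounded cell -> asymptotic_to N size cell f l.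
Proof.
move=> /bounded_cell[Q hQ] e e0; exists Q => x /hQ xQ.
by rewrite ltnNge xQ.
Qed.

Lemma label_unique N cell (f : T -> nat) (K K' : nat) (l l' : label R) :
  (0 < N)%N -> unbounded cell -> valid_label K l -> valid_label K' l' ->
  asymptotic_to N size cell f l -> asymptotic_to N size cell f l' -> l = l'.
Proof.
move=> N0 /large_consistent cF.
have ge0 (d : nat) : 0 <= d%:R / N%:R :> R by rewrite divr_ge0.
case: l l' => [d mu] [d' mu'] v v' /asymptotic_rate /= h /asymptotic_rate /= h'.
have soo := large_oo cell.
case: v v' => [[_ /= mu0]|[d0 mu0]] [[_ /= mu'0]|[d'0 mu'0]]; subst.
- have [+ ->] := rate_unique (largeP cell) soo cF mu0 mu'0 h h'.
  move=> /(congr1 (fun x => x * N%:R)); rewrite !divfK ?pnatr_eq0 -?lt0n//.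
  by move=> /eqP; rewrite eqr_nat => /eqP ->.
- rewrite mul0r in h'.
  by case: (rate0_absurd (largeP cell) soo cF (ge0 d) mu0 h' h).
- rewrite mul0r in h.
  by case: (rate0_absurd (largeP cell) soo cF (ge0 d') mu'0 h h').
- by [].
Qed.

(* Counts are natural numbers, so a negative exponent would force them to
   vanish for large sizes. *)
Lemma good_label N K r cell (f : T -> nat) :
  (0 < N)%N -> (forall x, cell x -> (f x <= K * size x ^ r)%N) ->
  good (large cell) (fun x => (size x)%:R : R) N (fun x => (f x)%:R) ->
  exists l : label R, valid_label (N * r) l /\ asymptotic_to N size cell f l.
Proof.
move=> N0 fK gf.
have [uc|/asymptotic_bounded bc] := pselect (unbounded cell); last first.
  by exists (0%N, 0); split; [right|exact: bc].
have cF := large_consistent uc; have FF := largeP cell.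
have soo := large_oo cell.
case: gf => [[Q hQ]|[d [mu [mu0 fd]]]].
  exists (0%N, 0); split; first by right.
  move=> e e0; exists Q => x cx Qx; rewrite (hQ x cx Qx) mul0r subr0 normr0.
  by rewrite mulr_ge0 ?powR_ge0// ltW.
have d0 : 0 <= d.
  have f1 : large cell (fun x => 1 <= (f x)%:R :> R).
    apply: (ev_sub FF) (rate_gt0 FF soo mu0 fd) => x.
    by rewrite ltr0n ler1n.
  have := rate_le FF soo cF ltr01 f1 (rate_cst FF _ 1) fd.
  by rewrite pmulr_lge0 ?invr_gt0 ?ltr0n// ler0z.
case: d d0 fd => // d _; rewrite -pmulrn => fd.
exists (d, mu); split; last exact/asymptotic_rate.
left; split=> //=.
(* Comparison with K size^r, whose exponent is r, gives d / N <= r. *)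
have fr : large cell (fun x => (f x)%:R <= K%:R * (size x)%:R `^ r%:R :> R).
  exists 0%N => x cx _; rewrite powR_mulrn// -natrX -natrM ler_nat.
  exact: fK.
have rr : rate (large cell) (fun x => (size x)%:R)
    (fun x => K%:R * (size x)%:R `^ r%:R) (r%:R : R) K%:R.
  have := rateM FF soo (rate_cst FF _ K%:R) (rate_pow FF soo r%:R).
  by rewrite add0r mulr1.
have := rate_le FF soo cF mu0 fr fd rr.
by rewrite ler_pdivrMr ?ltr0n// -natrM ler_nat mulnC.
Qed.

End Large.

(** Growth depends on sizes and values only. This restricts it to subcells, carries it along
    renamings of variables, and passes from environments in the hosts to elements of the target
    class. *)
Lemma good_image (R : realType) (T T' : Type) (size : T -> nat)
    (size' : T' -> nat) (cell : T -> Prop) (cell' : T' -> Prop) N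
    (f : T -> R) (f' : T' -> R) :
  (forall x', cell' x' ->
    exists x, [/\ cell x, size x = size' x' & f x = f' x']) ->
  good (large size cell) (fun x => (size x)%:R%R) N f ->
  good (large size' cell') (fun x => (size' x)%:R%R) N f'.
Proof.
move=> h [[Q hQ]|[d [mu [mu0 fd]]]]; [left|right].
  by exists Q => x' /h[x [cx <- <-]]; exact: hQ.
exists d, mu; split=> // e e0; have [Q hQ] := fd e e0.
by exists Q => x' /h[x [cx <- <-]]; exact: hQ.
Qed.

(** * Partitions indexed by their labels *)

Section MergeLabels.
Variables (R : realType) (X : Type) (J : finType) (cell : J -> X -> bool).
Variable lab : J -> nat * R.

Definition merged_labels : seq (nat * R) := undup (codom lab).

(** In an asymptotic class the cells are indexed by labels, while the partitions built below may
    repeat a label; cells with equal labels are therefore united. *)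
Definition merged_cell (l : nat * R) (x : X) : bool :=
  [exists j, (lab j == l) && cell j x].

Lemma merged_labelsP l : l \in merged_labels <-> exists j, l = lab j.
Proof. by rewrite mem_undup; split=> [/codomP|[j ->]]; last exact: codom_f. Qed.

Lemma merged_unique x : (exists! j, cell j x) ->
  exists! l, l \in merged_labels /\ merged_cell l x.
Proof.
move=> [j [cj uj]]; exists (lab j); split.
  split; first by apply/merged_labelsP; exists j.
  by apply/existsP; exists j; rewrite eqxx.
by move=> l [_ /existsP[i /andP[/eqP <- /uj ->]]].
Qed.

Lemma merged_asymptotic N (size : X -> nat) (P : X -> Prop) (f : X -> nat) l :
  (forall j, asymptotic_to N size (fun x => P x /\ cell j x) f (lab j)) ->
  asymptotic_to N size (fun x => P x /\ merged_cell l x) f l.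
Proof.
move=> h e e0.
pose Q j := sval (cid (h j e e0)).
exists (\max_j Q j)%N => x [Px /existsP[j /andP[/eqP <- cj]]] Qx.
apply: (svalP (cid (h j e e0))) => //.
by apply: leq_ltn_trans Qx; exact: leq_bigmax.
Qed.

End MergeLabels.

(** * Tame functions *)

Section Tame.
Local Open Scope classical_set_scope.
Local Open Scope ring_scope.
Variables (R : realType) (L : language) (N : nat) (C : structure L -> Prop).
Hypothesis C_class : asymptotic_class R N C.
Local Notation member := {M : structure L | C M}.

Definition point (V : Type) (c : V -> srt L) := {M : member & env (sval M) c}.
Definition point_size (V : Type) (c : V -> srt L) (x : point c) : nat :=
  str_size (sval (tag x)).

(* Negative exponents are allowed, so that inverses of counts are tame. *)
Definition tame (V : Type) (c : V -> srt L)
    (f : forall M : member, env (sval M) c -> R) : Prop :=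
  exists (J : finType) (k : forall M : member, env (sval M) c -> J),
    (forall j, definable (fun M e => k M e == j)) /\
    forall j, good (large (@point_size V c) (fun x => k (tag x) (tagged x) = j))
      (fun x => (point_size x)%:R) N (fun x => f (tag x) (tagged x)).

Let N_gt0 : (0 < N)%N := proj1 C_class.

Section Closure.
Variables (V : Type) (c : V -> srt L).
Implicit Types f g : forall M : member, env (sval M) c -> R.

Let ff (cell : point c -> Prop) := largeP (@point_size V c) cell.
Let soo (cell : point c -> Prop) := @large_oo R _ (@point_size V c) cell.

Lemma tame_ext f g : (forall M e, f M e = g M e) -> tame f -> tame g.
Proof.
move=> fg; congr tame; apply: functional_extensionality_dep => M.
exact/funext.
Qed.

Lemma tame_cst (a : R) : 0 <= a -> tame (fun M (e : env (sval M) c) => a).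
Proof.
move=> a0; exists unit, (fun _ _ => tt); split=> [[]|[]].
  by apply: definable_ext (definable_const _ _ true).
exact: (good_cst (ff (fun=> tt = tt)) _ N a0).
Qed.

Lemma tame_sat (f : forall M : member, env (sval M) c -> bool) :
  definable f -> tame (fun M e => (f M e)%:R).
Proof.
move=> df; exists bool, f; split=> [[]|b].
- by apply: definable_ext df => M e; rewrite eqb_id.
- by apply: definable_ext (definable_neg df) => M e; rewrite eqbF_neg.
apply: (good_ext (ff _) _
  (good_cst (ff _) (fun x => (point_size x)%:R) N (ler0n R b))).
by exists 0%N => x -> _.
Qed.

(** Pairs of indices give a common refinement of the two partitions, with both functions [good] on
    each piece. *)
Lemma tame_op2 (op : R -> R -> R) f g :
  (forall cell F G,
     good (large (@point_size V c) cell) (fun x => (point_size x)%:R) N F ->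
     good (large (@point_size V c) cell) (fun x => (point_size x)%:R) N G ->
     good (large (@point_size V c) cell) (fun x => (point_size x)%:R) N
       (fun x => op (F x) (G x))) ->
  tame f -> tame g -> tame (fun M e => op (f M e) (g M e)).
Proof.
move=> hop [J [k [dk gf]]] [J' [k' [dk' gg]]].
exists (J * J')%type, (fun M e => (k M e, k' M e)); split=> [[j j']|[j j']].
  by apply: definable_ext (definable_and (dk j) (dk' j')) => M e.
by apply: hop; [apply: good_image (gf j)|apply: good_image (gg j')];
  move=> x [kx k'x]; exists x.
Qed.

Lemma tameD f g : tame f -> tame g -> tame (fun M e => f M e + g M e).
Proof.
apply: tame_op2 => cell F G hF hG.
exact: (goodD (ff cell) (soo cell) N_gt0 hF hG).
Qed.

Lemma tameM f g : tame f -> tame g -> tame (fun M e => f M e * g M e).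
Proof.
apply: tame_op2 => cell F G hF hG.
exact: (goodM (ff cell) (soo cell) hF hG).
Qed.

Lemma tameV f : tame f -> tame (fun M e => (f M e)^-1).
Proof.
move=> [J [k [dk gf]]]; exists J, k; split=> // j.
exact: (goodV (ff _) (gf j)).
Qed.

Lemma tame_sum (J : finType)
    (F : J -> forall M : member, env (sval M) c -> R) :
  (forall j, tame (F j)) -> tame (fun M e => \sum_j F j M e).
Proof.
move=> tF; rewrite /index_enum; elim: (Finite.enum _) => [|j s IH].
  by apply: tame_ext (tame_cst (lexx 0)) => M e; rewrite big_nil.
by apply: tame_ext (tameD (tF j) IH) => M e; rewrite big_cons.
Qed.

End Closure.

Lemma tame_pull (V W : Type) (c : V -> srt L) (c' : W -> srt L)
    (t : V -> W) (H : forall v, c v = c' (t v)) f :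
  tame f -> tame (fun M (e : env (sval M) c') => f M (env_pull (sval M) H e)).
Proof.
move=> [J [k [dk gf]]].
exists J, (fun M e => k M (env_pull (sval M) H e)); split=> [j|j].
  exact: (definable_pull H (dk j)).
apply: good_image (gf j) => x kx.
by exists (existT _ (tag x) (env_pull (sval (tag x)) H (tagged x))).
Qed.

(** The one place where the counting clause of the class is invoked. The index of a cell is the
    label that holds there, and the value [None] is never taken. *)
Lemma tame_count (V : finType) (c : V -> srt L) (s : srt L)
    (f : forall M : member, env (sval M) (ctx_ext c s) -> bool) :
  definable f ->
  tame (fun M (e : env (sval M) c) =>
          #|[pred a | f M (ext_env (X := fun s => carrier (sval M) s) e a)]|%:R).
Proof.
move=> [p hp]; pose c0 (i : 'I_#|V|) := c (enum_val i).
have H o : ctx_ext c s o = ctx_ext c0 s (omap enum_rank o).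
  by case: o => [v|] //=; rewrite /c0 enum_rankK.
have [p0 hp0] := formula_pull H p.
have [D [theta [Dv Du Da]]] := C_class.2 s _ c0 p0.
pose D' : seq (nat * R) := D.
pose e0 (M : member) (e : env (sval M) c) : env (sval M) c0 :=
  fun i => e (enum_val i).
pose k (M : member) (e : env (sval M) c) : option (seq_sub D') :=
  [pick l | sat (theta (val l)) (e0 M e)].
have kP M e l : (k M e == Some l) = sat (theta (val l)) (e0 M e).
  rewrite /k; case: pickP => [l' hl'|h]; last by rewrite (h l).
  apply/eqP/idP => [[<-//]|hl]; congr Some; apply: val_inj.
  have [l0 [_ ul]] := Du _ (svalP M) (e0 M e).
  by rewrite -(ul (val l)) ?(ul (val l')) //; split=> //; exact: ssvalP.
have kN M e : k M e == None = false.
  apply/negP => /eqP kn.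
  have [l0 [[hl0 sl0] _]] := Du _ (svalP M) (e0 M e).
  by have := kP M e (SeqSub hl0); rewrite kn /= sl0.
have cnt M e : #|[pred a | f M (ext_env (X := fun s => carrier (sval M) s) e a)]| =
    nb_sol p0 (e0 M e).
  rewrite /nb_sol; apply: eq_card => a; rewrite !inE hp0 -hp; congr sat.
  apply/esym/pull_eq => -[v|] //=.
  exact: (congr1 (fun w => Tagged (fun s => carrier (sval M) s) (e w))
    (enum_rankK v)).
exists (option (seq_sub D')), k; split=> [[l|]|[l|]].
- have := definable_pull (C := C) (fun i : 'I_#|V| => erefl (c (enum_val i)))
    (definable_sat C (theta (val l))).
  by apply: definable_ext => M e; rewrite kP.
- by apply: definable_ext (definable_false _ _) => M e; rewrite kN.
- have as_l : asymptotic_to N (@point_size V c)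
      (fun x => k (tag x) (tagged x) = Some l)
      (fun x => nb_sol p0 (e0 (tag x) (tagged x))) (ssval l).
    move=> e e_gt0; have [Q hQ] := Da _ (ssvalP l) e e_gt0; exists Q => x kx Qx.
    apply: (hQ (existT _ (sval (tag x)) (e0 (tag x) (tagged x)))) => //=.
    by split; [exact: svalP|rewrite -kP; exact/eqP].
  apply: (good_ext (largeP _ _)
    (f := fun x => (nb_sol p0 (e0 (tag x) (tagged x)))%:R)).
    by exists 0%N => x _ _; rewrite cnt.
  case: (Dv _ (ssvalP l)) => [[_ l0]|l0].
    right; exists (ssval l).1%:Z, (ssval l).2; split=> //.
    exact/asymptotic_rate.
  (* For the label (0, 0) the count is eventually at most 1/2, and a natural number at most 1/2 is
     zero. *)
  left; have [Q hQ] := as_l (2^-1) ltac:(by rewrite invr_gt0).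
  exists Q => x kx Qx; have := hQ x kx Qx.
  rewrite l0 /= !mul0r powRr0 mulr1 subr0 ger0_norm ?ler0n//.
  case: (nb_sol _ _) => // n; rewrite leNgt => /negP[].
  by apply: (@lt_le_trans _ _ 1); rewrite ?ler1n// invf_lt1// ltr1n.
- by left; exists 0%N => x /eqP; rewrite kN.
Qed.

(** The sum is split according to the cell j of the summand. On cell j it is the number [n] of
    terms, tame by [tame_count], times the average [g], which inherits the growth of the summand
    because the latter is uniform in a. *)
Lemma tame_sum_var (V : finType) (c : V -> srt L) (s : srt L)
    (f : forall M : member, env (sval M) (ctx_ext c s) -> R) :
  tame f ->
  tame (fun M (e : env (sval M) c) =>
          \sum_a f M (ext_env (X := fun s => carrier (sval M) s) e a)).
Proof.
move=> [J [k [dk gf]]].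
pose ext (M : member) (e : env (sval M) c) a :=
  ext_env (X := fun s => carrier (sval M) s) (s := s) e a.
pose F j (M : member) (e : env (sval M) c) :=
  \sum_(a | k M (ext M e a) == j) f M (ext M e a).
apply: (@tame_ext _ _ (fun M e => \sum_j F j M e)) => [M e|].
  by rewrite (partition_big (fun a => k M (ext M e a)) xpredT).
apply: tame_sum => j.
have [J' [k' [dk' gn]]] := tame_count (dk j).
exists J', k'; split=> // i.
pose n (x : point c) := #|[pred a | k (tag x) (ext (tag x) (tagged x) a) == j]|.
have {}gn := gn i; pose cell (x : point c) := k' (tag x) (tagged x) = i.
have FF := largeP (@point_size V c) cell.
have soo := @large_oo R _ (@point_size V c) cell.
case: (gf j) => [[Q hQ]|[d [mu [mu0 fd]]]].
  left; exists Q => x _ Qx; rewrite /F big1 // => a /eqP ka.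
  exact: (hQ (existT _ (tag x) (ext _ _ a))).
pose al : R := d%:~R / N%:R.
(* An empty sum has no average; the value mu |M|^al keeps the growth rate of [g] valid there, and
   the factor n = 0 erases it from the product. *)
pose g (x : point c) := if n x == 0%N then mu * (point_size x)%:R `^ al
  else F j (tag x) (tagged x) / (n x)%:R.
have gg : good (large (@point_size V c) cell) (fun x => (point_size x)%:R) N g.
  right; exists d, mu; split=> // eps eps0.
  have [Q hQ] := fd eps eps0.
  exists Q => x cx Qx.
  have px : 0 < (point_size x)%:R `^ al :> R.
    by rewrite powR_gt0// ltr0n; case: point_size Qx.
  rewrite /g; case: eqP => [_|/eqP n0].
    by rewrite mulfK ?gt_eqF// subrr normr0 ltW.
  have n0' : (n x)%:R != 0 :> R by rewrite pnatr_eq0.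
  have sumk (z : R) :
      \sum_(a | k (tag x) (ext (tag x) (tagged x) a) == j) z = z * (n x)%:R.
    by rewrite mulr_natr -sumr_const.
  have -> : mu - F j (tag x) (tagged x) / (n x)%:R / (point_size x)%:R `^ al =
      (\sum_(a | k (tag x) (ext (tag x) (tagged x) a) == j)
         (mu - f (tag x) (ext (tag x) (tagged x) a) / (point_size x)%:R `^ al))
      / (n x)%:R.
    by rewrite sumrB sumk mulrBl -mulr_suml mulfK// mulrAC.
  rewrite normrM normfV normr_nat ler_pdivrMr ?ltr0n ?lt0n//.
  apply: le_trans (ler_norm_sum _ _ _) _.
  rewrite -sumk; apply: ler_sum => a /eqP ka.
  exact: (hQ (existT _ (tag x) (ext _ _ a))).
apply: (good_ext FF _ (goodM FF soo gn gg)).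
exists 0%N => x _ _; rewrite /g -/(n x); case: eqP => [n0|/eqP n0].
  rewrite n0 mul0r /F big_pred0 // => a.
  by have /card0_eq /(_ a) := n0.
by rewrite mulrC divfK// pnatr_eq0.
Qed.

Lemma tame_sum_block (r : nat) (V : finType) (c : V -> srt L)
    (d : 'I_r -> srt L)
    (f : forall M : member, env (sval M) (ctx_sum c d) -> R) :
  tame f ->
  tame (fun M (e : env (sval M) c) =>
    \sum_(u : {dffun forall i, sval M (d i)})
       f M (sum_env (X := fun s => carrier (sval M) s) e u)).
Proof.
move=> tf.
(* [aggregate_block] ranges over bare types, so finiteness is stated as equality with the carrier of
   a [finType]. *)
apply: (@aggregate_block L member (fun M => carrier (sval M)) R 0 +%R
  (fun V => exists W : finType, W = V :> Type)
  (fun V c f => @tame V c f) _ _ _ r V c d f) => //.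
- by move=> _ [W <-]; exists (option W : finType).
- by move=> *; exact: tame_pull.
- by move=> V' c' s g [W WV]; subst V'; exact: tame_sum_var.
- by exists V.
Qed.

End Tame.

(** * Counting in interpretations *)

Section Interpretations.
Variables (L L' : language) (C : structure L -> Prop) (D : structure L' -> Prop).
Variables (r : nat) (I : interpretation C D r).
Local Notation us := (code_us I).
Local Notation zs := (code_zs I).

(** All parameters in all structures of the class, not only the [param I A]: definability and
    tameness are global, while the interpretation is governed by its axioms only at
    [member_point A]. *)
Definition pointed := {M : {M : structure L | C M} & env (sval M) zs}.

(** The finite-type version of [rtuple], over which sums can be taken. *)
Definition tup (x : pointed) (t : srt L') : finType :=
  {dffun forall i : 'I_r, sval (tag x) (us t i)}.

Definition tup_fun (x : pointed) (t : srt L') (u : tup x t) :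
    rtuple I (sval (tag x)) t :=
  fun i => (u : {dffun forall i : 'I_r, sval (tag x) (us t i)}) i.

Definition fun_tup (x : pointed) (t : srt L') (u : rtuple I (sval (tag x)) t) :
    tup x t :=
  [ffun i => u i].

Lemma fun_tupK (x : pointed) (t : srt L') (u : rtuple I (sval (tag x)) t) :
  tup_fun (fun_tup (x := x) u) = u.
Proof.
by apply: functional_extensionality_dep => i; rewrite /tup_fun ffunE.
Qed.

Lemma tup_funK (x : pointed) (t : srt L') (u : tup x t) :
  fun_tup (tup_fun u) = u.
Proof. by apply/ffunP => i; rewrite ffunE. Qed.

Local Notation tup_pull x H v :=
  (pull (S := srt _) (X := fun s => tup x s) H v).
Local Notation tup_ext x v u := (ext_env (X := fun s => tup x s) v u).
Local Notation tup_sum x v u := (sum_env (X := fun s => tup x s) v u).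

Definition tup_env (x : pointed) (K : Type) (tau : K -> srt L')
    (v : forall k, tup x (tau k)) : env (sval (tag x)) (block_ctx us zs tau) :=
  block_env (us := us) (tau := tau) (fun k => tup_fun (v k)) (tagged x).

Definition env_point (K : Type) (tau : K -> srt L') (M : {M | C M})
    (e : env (sval M) (block_ctx us zs tau)) : pointed :=
  existT _ M (fun j => e (inr j)).

Definition env_tup (K : Type) (tau : K -> srt L') (M : {M | C M})
    (e : env (sval M) (block_ctx us zs tau)) (k : K) :
    tup (env_point e) (tau k) :=
  fun_tup (x := env_point e) (t := tau k) (fun i => e (inl (k, i))).

Definition tup_definable (K : Type) (tau : K -> srt L')
    (g : forall x : pointed, (forall k, tup x (tau k)) -> bool) : Prop :=
  definable (fun M (e : env (sval M) (block_ctx us zs tau)) =>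
               g (env_point e) (env_tup e)).

Lemma tup_envK (K : Type) (tau : K -> srt L') (M : {M | C M})
    (e : env (sval M) (block_ctx us zs tau)) :
  tup_env (env_tup e) = e.
Proof.
apply: functional_extensionality_dep => -[[k i]|j] //=.
by rewrite /tup_env /= fun_tupK.
Qed.

(** Phrased through an arbitrary [g] because the point rebuilt from [tup_env v] equals [x] only
    propositionally, so the tuples themselves have different types. *)
Lemma env_tupK (Z : Type) (x : pointed) (K : Type) (tau : K -> srt L')
    (g : forall x : pointed, (forall k, tup x (tau k)) -> Z)
    (v : forall k, tup x (tau k)) :
  g (env_point (M := tag x) (tup_env v)) (env_tup (M := tag x) (tup_env v)) =
  g x v.
Proof.
case: x v => M z v; rewrite /env_point /=; congr g.
apply: functional_extensionality_dep => k.
exact: (tup_funK (x := existT _ M z) (v k)).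
Qed.

Lemma tup_definableP (K : Type) (tau : K -> srt L')
    (g : forall x : pointed, (forall k, tup x (tau k)) -> bool) :
  tup_definable g ->
  exists rho : formula (block_ctx us zs tau),
    forall x v, sat rho (tup_env v) = g x v.
Proof.
by case=> rho h; exists rho => x v; rewrite (h (tag x)) env_tupK.
Qed.

Lemma tup_definable_sat (K : Type) (tau : K -> srt L')
    (rho : formula (block_ctx us zs tau)) :
  tup_definable (fun x v => sat rho (tup_env v)).
Proof.
by apply: definable_ext (definable_sat C rho) => M e; rewrite tup_envK.
Qed.

Lemma tup_definable_pull (K K2 : Type) (tau : K -> srt L') (tau2 : K2 -> srt L')
    (t : K -> K2) (H : forall k, tau k = tau2 (t k))
    (g : forall x : pointed, (forall k, tup x (tau k)) -> bool) :
  tup_definable g -> tup_definable (fun x v => g x (tup_pull x H v)).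
Proof.
have e : tau = tau2 \o t by exact/funext.
subst tau; have -> : H = (fun k => erefl) by apply: Prop_irrelevance.
move=> dg.
pose t' (y : K * 'I_r + 'I_(code_n I)) : K2 * 'I_r + 'I_(code_n I) :=
  match y with inl kj => inl (t kj.1, kj.2) | inr j => inr j end.
have H' y : block_ctx us zs (tau2 \o t) y = block_ctx us zs tau2 (t' y).
  by case: y.
apply: definable_ext (definable_pull H' dg) => M e.
have -> : env_pull (sval M) H' e =
    (fun y => match y return sval M (block_ctx us zs (tau2 \o t) y) with
     | inl kj => e (inl (t kj.1, kj.2)) | inr j => e (inr j) end).
  by apply: pull_eq; case.
by [].
Qed.

(** Splits the last block into [r] ordinary variables, so that quantifying or summing over it
    becomes an operation on a block of variables of the host. *)
Definition block_ext_var (K : Type)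
    (y : option K * 'I_r + 'I_(code_n I)) : (K * 'I_r + 'I_(code_n I)) + 'I_r :=
  match y with
  | inl (Some k, i) => inl (inl (k, i))
  | inl (None, i) => inr i
  | inr j => inl (inr j)
  end.

Lemma block_ext_ctx (K : Type) (tau : K -> srt L') (s : srt L') y :
  block_ctx us zs (ctx_ext tau s) y =
  ctx_sum (block_ctx us zs tau) (us s) (block_ext_var y).
Proof. by case: y => [[[k|] i]|j]. Qed.

Lemma block_ext_pull (Z K : Type) (tau : K -> srt L') (s : srt L')
    (g : forall x : pointed, (forall k, tup x (ctx_ext tau s k)) -> Z)
    (M : {M | C M}) (e : env (sval M) (block_ctx us zs tau))
    (u : {dffun forall i, sval M (us s i)})
    (e' := env_pull (sval M) (block_ext_ctx tau s)
             (sum_env (X := fun s => carrier (sval M) s) e u)) :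
  g (env_point e') (env_tup e') =
  g (env_point e) (tup_ext (env_point e) (env_tup e) u).
Proof.
have -> : e' = (fun y =>
   match y return sval M (block_ctx us zs (ctx_ext tau s) y) with
   | inl (Some k, i) => e (inl (k, i))
   | inl (None, i) => u i
   | inr j => e (inr j)
   end).
  by apply: pull_eq => -[[[k|] i]|j].
congr g; apply: functional_extensionality_dep => -[k|] //=.
exact: (tup_funK (x := env_point e) u).
Qed.

Lemma tup_definable_ex1 (K : Type) (tau : K -> srt L') (s : srt L')
    (g : forall x : pointed, (forall k, tup x (ctx_ext tau s k)) -> bool) :
  tup_definable g ->
  tup_definable (fun x v => [exists u : tup x s, g x (tup_ext x v u)]).
Proof.
move=> dg; apply: definable_ext
  (definable_ex_block (definable_pull (block_ext_ctx tau s) dg)) => M e.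
by apply: eq_existsb => u; rewrite (block_ext_pull g).
Qed.

Lemma tup_definable_ex_block (n : nat) (K : Type) (tau : K -> srt L')
    (d : 'I_n -> srt L')
    (g : forall x : pointed, (forall k, tup x (ctx_sum tau d k)) -> bool) :
  tup_definable g ->
  tup_definable (fun x v =>
    [exists u : {dffun forall i, tup x (d i)}, g x (tup_sum x v u)]).
Proof.
move=> dg.
have := @aggregate_block L' pointed tup bool false orb (fun _ => True)
  tup_definable.
move=> /(_ (fun _ => id)) /(_ _ _ n K tau d g Logic.I dg) h.
apply: definable_ext (h _ _) => [M e||].
- by rewrite big_orE.
- by move=> *; exact: tup_definable_pull.
move=> V' c' s g' _ dg'; apply: definable_ext (tup_definable_ex1 dg') => M e.
by rewrite big_orE.
Qed.

Definition in_X (x : pointed) (t : srt L') (u : tup x t) : bool :=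
  sat (code_delta I t) (tup_env (tau := fun _ : unit => t) (fun=> u)).

Definition in_E (x : pointed) (t : srt L') (u v : tup x t) : bool :=
  sat (code_eps I t)
    (tup_env (tau := fun _ : bool => t) (fun b => if b then v else u)).

Lemma in_XE (x : pointed) (t : srt L') (u : tup x t) :
  in_X u = Xset (tagged x) (tup_fun u) :> Prop.
Proof. by []. Qed.

Lemma in_EE (x : pointed) (t : srt L') (u v : tup x t) :
  in_E u v = Erel (tagged x) (tup_fun u) (tup_fun v) :> Prop.
Proof.
rewrite /in_E /Erel /tup_env; congr (is_true (sat _ (block_env _ _))).
by apply: functional_extensionality_dep => -[].
Qed.

Lemma tup_definable_X (K : Type) (tau : K -> srt L') (k : K) :
  tup_definable (tau := tau) (fun x v => in_X (v k)).
Proof.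
apply: definable_ext (tup_definable_pull (t := fun _ : unit => k)
  (fun _ => erefl (tau k)) (tup_definable_sat (code_delta I (tau k)))).
by [].
Qed.

Lemma tup_definable_E (K : Type) (tau : K -> srt L') (t : srt L')
    (k k' : K) (H : t = tau k) (H' : t = tau k') :
  tup_definable (tau := tau) (fun x v =>
    in_E (ecast s (tup x s) (esym H) (v k)) (ecast s (tup x s) (esym H') (v k'))).
Proof.
pose Hb (b : bool) : t = tau (if b then k' else k) :=
  if b return t = tau (if b then k' else k) then H' else H.
apply: definable_ext (tup_definable_pull Hb (tup_definable_sat (code_eps I t))).
move=> M e /=; rewrite /in_E; congr (sat _ (tup_env _)).
by apply: functional_extensionality_dep => -[].
Qed.

Definition member_point (A : {A | D A}) : pointed :=
  existT _ (alpha I A) (param I A).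

(** * Representatives of the elements of an interpreted structure *)

Section Classes.
Variables (A : {A : structure L' | D A}) (t : srt L').
Implicit Types (a b : sval A t) (u v : rtuple I (sval (alpha I A)) t).

(** Bijectivity only provides some generator [u0] of the class; symmetry and transitivity on X
    replace it by any representative. *)
Lemma iso_classE a u : iso_class a u ->
  iso_class a = [set v | Xset (param I A) v /\ Erel (param I A) u v]%classic.
Proof.
have [h _ _] := iso_class_bij I A t.
have [u0 X0 ->] := h a Logic.I => -[Xu Eu].
apply/seteqP; split=> v [Xv Ev]; split=> //.
  apply: (interp_trans Xu X0 Xv) => //; exact: (interp_sym X0 Xu).
exact: (interp_trans X0 Xu Xv).
Qed.

Lemma iso_class_X a u : iso_class a u -> Xset (param I A) u.
Proof. by move=> au; move: (au); rewrite (iso_classE au) => -[]. Qed.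

Lemma iso_class_ex a : exists u, iso_class a u.
Proof.
have [h _ _] := iso_class_bij I A t.
have [u Xu ->] := h a Logic.I; exists u; split=> //; exact: interp_refl.
Qed.

Lemma iso_class_surj u : Xset (param I A) u -> exists a, iso_class a u.
Proof.
move=> Xu; have [_ _ h] := iso_class_bij I A t.
have [|a _ ae] :=
  h [set v | Xset (param I A) v /\ Erel (param I A) u v]%classic.
  by exists u.
by exists a; rewrite ae; split=> //; exact: interp_refl.
Qed.

Lemma iso_class_inj a b u : iso_class a u -> iso_class b u -> a = b.
Proof.
move=> au bu; have [_ h _] := iso_class_bij I A t.
by apply: h; rewrite ?inE// (iso_classE au) (iso_classE bu).
Qed.

Lemma iso_class_E a u v : iso_class a u ->
  iso_class a v <-> Xset (param I A) v /\ Erel (param I A) u v.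
Proof. by move=> /iso_classE ->. Qed.

End Classes.

Definition reps (A : {A | D A}) (K : Type) (tau : K -> srt L')
    (v : forall k, tup (member_point A) (tau k)) (a : env (sval A) tau) : Prop :=
  forall k, iso_class (a k) (tup_fun (v k)).

Lemma reps_ex (A : {A | D A}) (K : Type) (tau : K -> srt L')
    (a : env (sval A) tau) :
  exists v : forall k, tup (member_point A) (tau k), reps v a.
Proof.
pose w k := sval (cid (iso_class_ex (a k))).
exists (fun k => fun_tup (x := member_point A) (w k)) => k.
by rewrite fun_tupK /w; case: cid.
Qed.

(** A function symbol is interpreted by its graph, so a term becomes the relation that [y]
    represents its value; nested applications are unfolded by quantifying over representatives of
    the arguments. *)
Lemma fterm_interp (K : Type) (tau : K -> srt L') (s : srt L')
    (t : fterm tau s) :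
  exists g : forall x : pointed, (forall k, tup x (ctx_ext tau s k)) -> bool,
    tup_definable g /\
    forall A (a : env (sval A) tau) v (y : tup (member_point A) s),
      reps v a ->
      g (member_point A) (tup_ext _ v y) <-> iso_class (teval a t) (tup_fun y).
Proof.
elim: t => [k|f t IH].
  exists (fun x (v : forall o, tup x (ctx_ext tau (tau k) o)) =>
    in_X (t := tau k) (v None) && in_E (t := tau k) (v (Some k)) (v None)).
  split.
    apply: definable_and.
      exact: (@tup_definable_X _ (ctx_ext tau (tau k)) None).
    exact: (@tup_definable_E _ (ctx_ext tau (tau k)) (tau k) (Some k) None
      erefl erefl).
  move=> A a v y va; rewrite (iso_class_E _ (va k)) /=; split.
    by move=> /andP[Xy Ey]; split=> //; rewrite -(in_EE (v k) y).
  by move=> [Xy Ey]; apply/andP; split=> //; rewrite in_EE.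
pose g i := sval (cid (IH i)).
have gP i := svalP (cid (IH i)).
pose s1 i (o : option K) : option K + 'I_(farity f) :=
  match o with Some k => inl (Some k) | None => inr i end.
have H1 i o : ctx_ext tau (fdom i) o =
    ctx_sum (ctx_ext tau (fcod f)) (fdom (f := f)) (s1 i o) by case: o.
pose s2 (o : option 'I_(farity f)) : option K + 'I_(farity f) :=
  match o with Some i => inr i | None => inl None end.
have H2 o : ctx_ext (fdom (f := f)) (fcod f) o =
    ctx_sum (ctx_ext tau (fcod f)) (fdom (f := f)) (s2 o) by case: o.
(* The conjunct [in_X] is needed: [code_fun] is constrained only on tuples that represent
   elements. *)
pose G x (v : forall k, tup x
     (ctx_sum (ctx_ext tau (fcod f)) (fdom (f := f)) k)) :=
  [&& in_X (t := fcod f) (v (inl None)), [forall i, g i x (tup_pull x (H1 i) v)]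
    & sat (code_fun I f) (tup_env (tup_pull x H2 v))].
exists (fun x v => [exists u : {dffun forall i, tup x (fdom i)},
                      G x (tup_sum x v u)]); split.
  apply: tup_definable_ex_block; apply: definable_and.
    exact: (@tup_definable_X _ (ctx_sum (ctx_ext tau (fcod f)) _) (inl None)).
  apply: definable_and.
    apply: definable_forall => i; exact: (tup_definable_pull (H1 i) (gP i).1).
  exact: (tup_definable_pull H2 (tup_definable_sat (code_fun I f))).
move=> A a v y va; set x := member_point A.
have e1 i (u : {dffun forall i, tup x (fdom (f := f) i)}) :
    tup_pull x (H1 i) (tup_sum x (tup_ext x v y) u) = tup_ext x v (u i).
  by apply: pull_eq => -[].
have e2 (u : {dffun forall i, tup x (fdom (f := f) i)}) :
    tup_pull x H2 (tup_sum x (tup_ext x v y) u) =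
    tup_ext x (u : forall i, tup x (fdom (f := f) i)) y.
  by apply: pull_eq => -[].
have key (u : {dffun forall i, tup x (fdom (f := f) i)}) b :
    iso_class b (tup_fun y) ->
    (forall i, iso_class (teval a (t i)) (tup_fun (u i))) ->
    sat (code_fun I f)
      (tup_env (tup_pull x H2 (tup_sum x (tup_ext x v y) u))) =
    (fun_of (fun i => teval a (t i)) == b).
  move=> yb ui.
  rewrite -(interp_fun (A := A) (a := fun i => teval a (t i)) (b := b)
    (v := fun k => tup_fun (tup_ext x (u : forall i, tup x (fdom i)) y k)));
    last by case.
  by rewrite e2.
split=> [/existsP[u /and3P[Xy /forallP gu]]|ay].
  have [b yb] := iso_class_surj Xy.
  have ui i : iso_class (teval a (t i)) (tup_fun (u i)).
    by apply/((gP i).2 A a v (u i) va); have := gu i; rewrite e1.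
  by rewrite (key u b yb ui) => /eqP /= ->.
have [w wa] := reps_ex (fun i => teval a (t i)).
pose u : {dffun forall i, tup x (fdom (f := f) i)} := finfun w.
have ui i : iso_class (teval a (t i)) (tup_fun (u i)).
  by rewrite /u ffunE; exact: wa.
apply/existsP; exists u; apply/and3P; split.
- exact: iso_class_X ay.
- by apply/forallP => i; rewrite e1; apply/((gP i).2 A a v (u i) va).
- by rewrite (key u _ ay ui).
Qed.

Lemma formula_interp (K : Type) (tau : K -> srt L') (p : formula tau) :
  exists g : forall x : pointed, (forall k, tup x (tau k)) -> bool,
    tup_definable g /\
    forall A (a : env (sval A) tau) v,
      reps v a -> g (member_point A) v = sat p a.
Proof.
elim: p => {K tau} [K tau|K tau s t u|K tau P t|K tau p [g [dg gP]] q [h [dh hP]]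
  |K tau s p [g [dg gP]]].
- by exists (fun _ _ => false); split=> //; exact: definable_false.
- have [g [dg gP]] := fterm_interp t; have [h [dh hP]] := fterm_interp u.
  (* Distinct elements share no representative, so two terms are equal exactly when some tuple
     represents both values. *)
  exists (fun x v => [exists y : tup x s,
    g x (tup_ext x v y) && h x (tup_ext x v y)]); split.
    apply: (@tup_definable_ex1 _ tau s (fun x v => g x v && h x v)).
    exact: definable_and dg dh.
  move=> A a v va /=; apply/existsP/eqP => [[y /andP[]]|tu].
    by move=> /(gP _ _ _ _ va) ty /(hP _ _ _ _ va) uy; exact: iso_class_inj ty uy.
  have [w aw] := iso_class_ex (teval a t).
  exists (fun_tup (x := member_point A) w); apply/andP; split.
    by apply/(gP _ _ _ _ va); rewrite fun_tupK.
  by apply/(hP _ _ _ _ va); rewrite fun_tupK -tu.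
- pose g i := sval (cid (fterm_interp (t i))).
  have gP i := svalP (cid (fterm_interp (t i))).
  pose s1 i (o : option K) : K + 'I_(rarity P) :=
    match o with Some k => inl k | None => inr i end.
  have H1 i o : ctx_ext tau (rdom i) o =
      ctx_sum tau (rdom (P := P)) (s1 i o) by case: o.
  pose G x (v : forall k, tup x (ctx_sum tau (rdom (P := P)) k)) :=
    [forall i, g i x (tup_pull x (H1 i) v)]
    && sat (code_rel I P) (tup_env (fun i => v (inr i))).
  exists (fun x v => [exists u : {dffun forall i, tup x (rdom i)},
                        G x (tup_sum x v u)]); split.
    apply: tup_definable_ex_block; apply: definable_and.
      apply: definable_forall => i; exact: (tup_definable_pull (H1 i) (gP i).1).
    exact: (tup_definable_pull (t := inr)
      (fun i => erefl (ctx_sum tau (rdom (P := P)) (inr i)))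
      (tup_definable_sat (code_rel I P))).
  move=> A a v va; set x := member_point A.
  have e1 i (u : {dffun forall i, tup x (rdom (P := P) i)}) :
      tup_pull x (H1 i) (tup_sum x v u) = tup_ext x v (u i).
    by apply: pull_eq => -[].
  have key (u : {dffun forall i, tup x (rdom (P := P) i)}) :
      (forall i, iso_class (teval a (t i)) (tup_fun (u i))) ->
      sat (code_rel I P) (tup_env (fun i => tup_sum x v u (inr i))) =
      rel_of (fun i => teval a (t i)).
    move=> ui; exact: (interp_rel (A := A) (a := fun i => teval a (t i))
      (v := fun i => tup_fun (u i))).
  apply/existsP/idP => [[u /andP[/forallP gu]]|ha].
    rewrite key // => i.
    by apply/((gP i).2 A a v (u i) va); have := gu i; rewrite e1.
  have [w wa] := reps_ex (fun i => teval a (t i)).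
  pose u : {dffun forall i, tup x (rdom (P := P) i)} := finfun w.
  have ui i : iso_class (teval a (t i)) (tup_fun (u i)).
    by rewrite /u ffunE; exact: wa.
  exists u; apply/andP; split; last by rewrite key.
  by apply/forallP => i; rewrite e1; apply/((gP i).2 A a v (u i) va).
- exists (fun x v => g x v ==> h x v); split; first exact: definable_imp.
  by move=> A a v va /=; rewrite (gP _ _ _ va) (hP _ _ _ va).
(* The quantifier is relativised to X: every tuple there represents an element, and every element
   has such a tuple. *)
exists (fun x v => ~~ [exists u : tup x s, in_X u && ~~ g x (tup_ext x v u)]).
split.
  apply/definable_neg/(@tup_definable_ex1 K tau s
    (fun x v => in_X (v None) && ~~ g x v)); apply: definable_and.
    exact: (@tup_definable_X _ (ctx_ext tau s) None).
  exact: definable_neg.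
move=> A a v va /=.
have key (u : tup (member_point A) s) b : iso_class b (tup_fun u) ->
    g (member_point A) (tup_ext (member_point A) v u) = sat p (env_ext a b).
  by move=> bu; apply: gP => -[k|]; [exact: va|exact: bu].
rewrite negb_exists; apply/forallP/forallP => h.
  move=> b; have [w bw] := iso_class_ex b.
  pose u := fun_tup (x := member_point A) w.
  have bu : iso_class b (tup_fun u) by rewrite fun_tupK.
  have Xu : in_X u by exact: iso_class_X bu.
  by have := h u; rewrite Xu /= negbK (key u b bu).
move=> u; apply/negP => /andP[Xu].
have [b bu] := iso_class_surj Xu.
by rewrite (key u b bu) (h b).
Qed.

Section Counting.
Local Open Scope ring_scope.
Variables (R : realType) (N : nat).
Hypothesis C_class : asymptotic_class R N C.

Definition tup_tame (K : Type) (tau : K -> srt L')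
    (F : forall x : pointed, (forall k, tup x (tau k)) -> R) : Prop :=
  tame N (fun M (e : env (sval M) (block_ctx us zs tau)) =>
            F (env_point e) (env_tup e)).

Lemma tup_tame_sum (K : finType) (tau : K -> srt L') (s : srt L')
    (F : forall x : pointed, (forall k, tup x (ctx_ext tau s k)) -> R) :
  tup_tame F ->
  tup_tame (fun x v => \sum_(u : tup x s) F x (tup_ext x v u)).
Proof.
move=> tF.
apply: tame_ext (tame_sum_block C_class (tame_pull (block_ext_ctx tau s) tF)).
by move=> M e; apply: eq_bigr => u _; rewrite (block_ext_pull F).
Qed.

(* The number of classes is the sum over [X] of the inverse sizes of classes. *)
Lemma tame_nb_sol (K : finType) (tau : K -> srt L') (t : srt L')
    (phi : formula (ctx_ext tau t)) :
  exists F : forall x : pointed, (forall k, tup x (tau k)) -> R,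
    tup_tame F /\
    forall A (a : env (sval A) tau) v,
      reps v a -> F (member_point A) v = (nb_sol phi a)%:R.
Proof.
have [g [dg gP]] := formula_interp phi.
pose cl (x : pointed) (v : forall o, tup x (ctx_ext tau t o)) : R :=
  \sum_(w : tup x t) (in_X w && in_E (t := t) (v None) w)%:R.
pose f (x : pointed) (v : forall o, tup x (ctx_ext tau t o)) : R :=
  (in_X (t := t) (v None) && g x v)%:R * (cl x v)^-1.
exists (fun x v => \sum_(u : tup x t) f x (tup_ext x v u)); split.
  apply: tup_tame_sum.
  have t1 : tup_tame (tau := ctx_ext tau t)
      (fun x v => (in_X (t := t) (v None) && g x v)%:R).
    apply: tame_sat; apply: definable_and => //.
    exact: (@tup_definable_X _ (ctx_ext tau t) None).
  have t2 : tup_tame cl.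
    apply: (@tup_tame_sum _ (ctx_ext tau t) t (fun x v =>
      (in_X (t := t) (v None) && in_E (t := t) (v (Some None)) (v None))%:R)).
    apply: tame_sat; apply: definable_and.
      exact: (@tup_definable_X _ (ctx_ext (ctx_ext tau t) t) None).
    exact: (@tup_definable_E _ (ctx_ext (ctx_ext tau t) t) t (Some None) None
      erefl erefl).
  exact: (tameM t1 (tameV t2)).
move=> A a v va; set x := member_point A.
pose ib (b : sval A t) (u : tup x t) : bool := `[< iso_class b (tup_fun u) >].
pose n b : R := \sum_(u : tup x t) (ib b u)%:R.
have n0 b : n b != 0.
  have [w bw] := iso_class_ex b.
  rewrite /n (bigD1 (fun_tup (x := x) w)) //= gt_eqF// ltr_pwDl ?sumr_ge0//.
  by rewrite /ib fun_tupK (asboolT bw).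
transitivity (\sum_(b : sval A t) (sat phi (env_ext a b))%:R : R); last first.
  by rewrite /nb_sol -sum1_card natr_sum [RHS]big_mkcond; apply: eq_bigr => b _;
    rewrite inE; case: sat.
(* Double counting: b receives weight 1 / n b from each of its n b representatives. After the
   exchange, a tuple of X contributes only through the class containing it, and a tuple outside X
   contributes nothing. *)
transitivity (\sum_(b : sval A t) \sum_(u : tup x t)
    (sat phi (env_ext a b))%:R * (ib b u)%:R / n b : R); last first.
  apply: eq_bigr => b _; rewrite -mulr_suml -mulr_sumr -/(n b).
  by rewrite mulfK.
rewrite exchange_big; apply: eq_bigr => u _.
have -> : f x (tup_ext x v u) = (in_X u && g x (tup_ext x v u))%:R *
    (\sum_(w : tup x t) (in_X w && in_E u w)%:R)^-1 by [].
have [Xu|nXu] := boolP (in_X u); last first.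
  rewrite mul0r big1 // => b _.
  rewrite /ib asboolF ?mulr0 ?mul0r// => /iso_class_X.
  exact/negP.
have [b bu] := iso_class_surj Xu.
have gb : g x (tup_ext x v u) = sat phi (env_ext a b).
  by apply: gP => -[k|]; [exact: va|exact: bu].
rewrite gb (bigD1 b) //= [X in _ + X]big1 ?addr0 => [|b' b'b].
  rewrite /ib (asboolT bu) mulr1; congr (_ / _); apply: eq_bigr => w _.
  congr ((_ : bool)%:R); apply/idP/asboolP.
    by move=> /andP[Xw]; rewrite in_EE => Ew; apply/(iso_class_E _ bu).
  by move=> /(iso_class_E _ bu)[Xw Ew]; apply/andP; split=> //; rewrite in_EE.
rewrite /ib asboolF ?mulr0 ?mul0r// => b'u.
by move: b'b; rewrite (iso_class_inj b'u bu) eqxx.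
Qed.

End Counting.

End Interpretations.

(** * Ambient partitions and descent *)

Section Partitions.
Local Open Scope ring_scope.
Variables (R : realType) (N : nat) (L L' : language).
Variables (C : structure L -> Prop) (D : structure L' -> Prop).
Variables (r : nat) (I : interpretation C D r).
Local Notation us := (code_us I).
Local Notation zs := (code_zs I).
Local Notation member := {A : structure L' | D A}.

(** A choice of representatives embeds a sort of A into a set of r-tuples of the host. *)
Lemma card_sort_le (A : member) t : (#|sval A t| <= str_size (host I A) ^ r)%N.
Proof.
pose x := member_point I A.
have inj : injective (fun a : sval A t =>
    fun_tup (x := x) (sval (cid (iso_class_ex I a)))).
  move=> a b /(congr1 (@tup_fun _ _ _ _ _ _ _ _)); rewrite !fun_tupK.
  case: cid => u au; case: cid => w bw /= uw.
  by apply: (iso_class_inj au); rewrite uw.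
apply: (leq_trans (leq_card _ inj)).
rewrite card_dep_ffun.
have le_prod (e : seq 'I_r) :
    (foldr muln 1 [seq #|sval (tag x) (us t i)| | i <- e]
    <= str_size (host I A) ^ size e)%N.
  elim: e => [|i e IH] //=; rewrite expnS leq_mul//.
  by rewrite /str_size (bigD1 (us t i)) //= leq_addr.
by apply: leq_trans (le_prod (enum 'I_r)) _; rewrite size_enum_ord.
Qed.

Lemma nb_sol_le_sort (A : member) (V : Type) (c : V -> srt L') (s : srt L')
    (p : formula (ctx_ext c s)) (b : env (sval A) c) :
  (nb_sol p b <= #|sval A s|)%N.
Proof. exact: max_card. Qed.

Lemma str_size_le (A : member) :
  (str_size (sval A) <= #|srt L'| * str_size (host I A) ^ r)%N.
Proof.
rewrite /str_size -sum_nat_const; apply: leq_sum => t _; exact: card_sort_le.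
Qed.

Lemma card_sort_le_size (A : member) s : (#|sval A s| <= str_size (sval A))%N.
Proof. by rewrite /str_size (bigD1 s) //= leq_addr. Qed.

Hypothesis C_class : asymptotic_class R N C.

(** The count depends on b alone, but the index [k] is read off a representative tuple and may vary
    with it. [good_label] turns each growth rate into a valid label. *)
Lemma counting_partition_ex (t : srt L') (m : nat) (tau : 'I_m -> srt L')
    (phi : formula (ctx_ext tau t)) :
  inhabited (counting_partition R N I phi).
Proof.
have [F [[J [k [dk gk]]] FP]] := tame_nb_sol I C_class phi.
pose p j := sval (cid (dk j)).
have pP j M e : sat (p j) e = (k M e == j) by rewrite /p; case: cid.
pose cell j (x : {A : member & env (sval A) tau}) : Prop :=
  exists2 v, represents (I := I) v (tagged x)
    & sat (p j) (block_env v (param I (tag x))).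
have lab j : exists l : label R, valid_label (N * r) l /\
    asymptotic_to N (fun x => str_size (host I (tag x))) (cell j)
      (fun x => nb_sol phi (tagged x)) l.
  apply: (good_label (K := 1) C_class.1) => [[A b] _|].
    rewrite mul1n (leq_trans (nb_sol_le_sort _ _))//; exact: card_sort_le.
  apply: good_image (gk j) => -[A b] [v vb]; rewrite (pP j (alpha I A)) => /eqP kj.
  exists (existT _ (alpha I A) (block_env v (param I A))); split=> //=.
  apply: (FP A b (fun i => fun_tup (x := member_point I A) (v i))) => i.
  by rewrite fun_tupK; exact: vb.
constructor.
apply: (@CountingPartition _ _ _ _ _ _ _ _ _ _ _ _ J
  (fun j => sval (cid (lab j))) p).
- by move=> j; case: cid => l [].
- move=> A v _; exists (k (alpha I A) (block_env v (param I A))).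
  split; first by rewrite (pP _ (alpha I A)).
  by move=> j; rewrite (pP _ (alpha I A)) => /eqP.
- by move=> j; case: cid => l [].
Qed.

Let tau0 : 'I_0 -> srt L' := fun i => False_rect _ (notF (ltn_ord i)).

Let zs_of_block (y : 'I_0 * 'I_r + 'I_(code_n I)) : 'I_(code_n I) :=
  match y with
  | inl (k, _) => False_rect _ (notF (ltn_ord k))
  | inr j => j
  end.

Let zs_of_blockE y : block_ctx us zs tau0 y = zs (zs_of_block y).
Proof. by case: y => [[[]]|]. Qed.

Lemma universe_partition_ex : inhabited (universe_partition R N I).
Proof.
(* The size of A is the sum over the sorts of the numbers of solutions of a true formula with no
   free variable other than the object variable. *)
pose true_form t : formula (ctx_ext tau0 t) := fimp (fbot _) (fbot _).
pose F t := sval (cid (tame_nb_sol I C_class (true_form t))).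
have FP t := svalP (cid (tame_nb_sol I C_class (true_form t))).
have tF := tame_sum C_class
  (F := fun t M (e : env (sval M) (block_ctx us zs tau0)) =>
          F t (env_point e) (env_tup e)) (fun t => (FP t).1).
have [J [k [dk gk]]] := tame_pull zs_of_blockE tF.
pose p j := sval (cid (dk j)).
have pP j M e : sat (p j) e = (k M e == j) by rewrite /p; case: cid.
have lab j : exists l : label R, valid_label (N * r) l /\
    asymptotic_to N (fun A => str_size (host I A))
      (fun A => True /\ sat (p j) (param I A)) (fun A => str_size (sval A)) l.
  apply: (good_label C_class.1) => [A _|]; first exact: str_size_le.
  apply: good_image (gk j) => A []; rewrite (pP j (alpha I A)) => _ /eqP kj.
  exists (existT _ (alpha I A) (param I A)); split=> //=.
  rewrite /str_size natr_sum; apply: eq_bigr => t _.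
  pose v (i : 'I_0) : tup (member_point I A) (tau0 i) :=
    False_rect _ (notF (ltn_ord i)).
  pose b : env (sval A) tau0 := fun i => False_rect _ (notF (ltn_ord i)).
  have -> : env_pull (sval (alpha I A)) zs_of_blockE (param I A) = tup_env v.
    by apply: pull_eq => -[[[]]|].
  have Fb : F t (member_point I A) v = (nb_sol (true_form t) b)%:R.
    by apply: (FP t).2 => -[].
  rewrite [LHS](env_tupK (F t) v) Fb.
  congr (_%:R); rewrite /nb_sol; exact: eq_card.

pose l j : nat * R := sval (cid (lab j)).
have lP j := svalP (cid (lab j)).
pose c (j : J) A := sat (p j) (param I A).
have dchi (e : label R) : definable (C := C)
    (fun M z => [exists j, (l j == e) && (k M z == j)]).
  apply: definable_exists => j; apply: definable_and => //.
  exact: definable_const.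
pose chi e := sval (cid (dchi e)).
have chiP e A : sat (chi e) (param I A) = merged_cell c l e A.
  rewrite /chi; case: cid => q qP /=; rewrite (qP (alpha I A)).
  by apply: eq_existsb => j; rewrite /c (pP j (alpha I A)).
constructor; apply: (@UniversePartition _ _ _ _ _ _ _ _ (merged_labels l) chi).
- by move=> e /merged_labelsP[j ->]; exact: (lP j).1.
- move=> A.
  have [|e [[e1 e2] eu]] := @merged_unique R member J c l A.
    exists (k (alpha I A) (param I A)); rewrite /c; split.
      by rewrite (pP _ (alpha I A)).
    by move=> j; rewrite (pP _ (alpha I A)) => /eqP.
  exists e; split; first by rewrite chiP.
  by move=> e'; rewrite chiP; exact: eu.
- move=> e _; have := merged_asymptotic e (fun j => (lP j).2).
  move=> h eps eps0; have [Q hQ] := h eps eps0; exists Q => A cA.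
  by apply: hQ; split=> //; rewrite -chiP.
Qed.

Hypothesis reflecting : quotient_trace_reflecting I.

(** A formula in the parameters alone is a formula on zero blocks, for which E-invariance is
    vacuous. *)
Lemma reflecting_universe_descent (U : universe_partition R N I) :
  universe_descent U.
Proof.
move=> l _.
have [rho hrho] := formula_pull (c := zs) (c' := block_ctx us zs tau0)
  (t := inr) (fun j => erefl) (chi U l).
have rhoE (A : member) v : sat rho (block_env (tau := tau0) v (param I A)) =
    sat (chi U l) (param I A).
  by rewrite hrho; congr sat; apply: pull_eq.
have [|q hq] := reflecting (rho := rho); first by move=> A v w *; rewrite !rhoE.
have [psi hpsi] := formula_pull (c := tau0) (c' := of_void (srt L'))
  (t := fun i => False_rect void (notF (ltn_ord i)))
  (fun i => match notF (ltn_ord i) with end) q.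
exists psi => A; rewrite hpsi.
have v0 (k : 'I_0) : rtuple I (host I A) (tau0 k) by case: k.
by rewrite (hq A _ v0) ?rhoE// => -[].
Qed.

(** Although [cp_theta i] need not be E-invariant, its saturation (some equivalent tuple satisfies
    it) is, hence it reflects to a formula expressing that i lies in the profile. A given profile is
    then a Boolean combination of these. *)
Lemma reflecting_profile_definable (t : srt L') (m : nat) (tau : 'I_m -> srt L')
    (phi : formula (ctx_ext tau t)) (Th : counting_partition R N I phi) :
  profile_definable Th.
Proof.
have trace i : exists q : formula tau,
    forall (A : member) (b : env (sval A) tau),
    sat q b = (i \in profile Th b).
  (* The blocks [inl k] are the given representatives, the blocks [inr k] the equivalent ones at
     which [cp_theta i] is tested. *)
  pose G x (v : forall k, tup (I := I) x (ctx_sum tau tau k)) :=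
    [forall k, in_X (t := tau k) (v (inr k)) &&
               in_E (t := tau k) (v (inl k)) (v (inr k))]
    && sat (cp_theta (c := Th) i) (tup_env (fun k => v (inr k))).
  have /tup_definableP[rho rhoP] : tup_definable (I := I) (tau := tau)
      (fun x v => [exists u : {dffun forall k, tup x (tau k)},
                     G x (sum_env (X := fun s => tup x s) v u)]).
    apply: tup_definable_ex_block; apply: definable_and.
      apply: definable_forall => k; apply: definable_and.
        exact: (@tup_definable_X _ _ _ _ _ _ _ (ctx_sum tau tau) (inr k)).
      exact: (@tup_definable_E _ _ _ _ _ _ _ (ctx_sum tau tau) (tau k)
        (inl k) (inr k) erefl erefl).
    exact: (tup_definable_pull (t := inr)
      (fun k => erefl (ctx_sum tau tau (inr k)))
      (tup_definable_sat (cp_theta (c := Th) i))).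
  have rhoE (A : member) (v : forall k, rtuple I (host I A) (tau k)) :
      sat rho (block_env v (param I A)) <->
      exists u : forall k, rtuple I (host I A) (tau k),
        (forall k, Xset (param I A) (u k) /\ Erel (param I A) (v k) (u k)) /\
        sat (cp_theta (c := Th) i) (block_env u (param I A)).
    pose x := member_point I A.
    have ve : block_env v (param I A) = tup_env (fun k => fun_tup (x := x) (v k)).
      rewrite /tup_env; congr block_env.
      by apply: functional_extensionality_dep => k; rewrite fun_tupK.
    rewrite (etrans (congr1 (sat rho) ve) (rhoP x _)).
    split=> [/existsP[u /andP[/forallP h su]]|[u [h su]]].
      exists (fun k => tup_fun (u k)); split=> // k.
      have /andP[Xu Eu] := h k; split=> //.
      by rewrite /= in_EE fun_tupK in Eu.
    pose u' : {dffun forall k, tup x (tau k)} :=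
      finfun (fun k => fun_tup (x := x) (u k)).
    have uE : (fun k => tup_fun (u' k)) = u.
      by apply: functional_extensionality_dep => k; rewrite ffunE fun_tupK.
    apply/existsP; exists u'; apply/andP; split.
      apply/forallP => k; have [Xu Eu] := h k; apply/andP; split.
        by rewrite /= in_XE ffunE fun_tupK.
      by rewrite /= in_EE ffunE !fun_tupK.
    by rewrite /tup_env /= uE.
  have [|q hq] := reflecting (rho := rho).
    move=> A v w Xv Xw Evw; apply/idP/idP => /rhoE[u [h su]]; apply/rhoE;
      exists u; split=> // k; have [Xu Eu] := h k; split=> //.
      by apply: (interp_trans (Xw k) (Xv k) Xu) => //; apply: interp_sym.
    exact: (interp_trans (Xv k) (Xw k) Xu).
  exists q => A b.
  have [v0 v0b] := reps_ex I b.
  pose v k := tup_fun (v0 k).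
  have vb : represents (I := I) v b by [].
  rewrite inE; apply/idP/asboolP => [/(hq A b v vb)/rhoE[u [h su]]|[u ub su]].
    by exists u => // k; apply/(iso_class_E _ (vb k)).
  apply/(hq A b v vb)/rhoE; exists u; split=> // k.
  exact/(iso_class_E _ (vb k)).
move=> P _; pose q i := sval (cid (trace i)).
have qP i (A : member) (b : env (sval A) tau) :
    sat (q i) b = (i \in profile Th b).
  by rewrite /q; case: cid.
have [psi hpsi] : definable (C := D) (c := tau)
    (fun A b => [forall i, if i \in P then sat (q i) b else ~~ sat (q i) b]).
  apply: definable_forall => i; case: (i \in P); first exact: definable_sat.
  exact/definable_neg/definable_sat.
exists psi => A b; rewrite hpsi; split=> [/forallP h|<-].
  apply/setP => i; have := h i; rewrite !qP.
  by case: ifP => // _ /negbTE.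
by apply/forallP => i; rewrite qP; case: ifP => // ->.
Qed.

End Partitions.

(** * Denominators *)

Section LcmSet.
Variable S : set nat.
Hypothesis S_fin : finite_set S.

Lemma dvdn_lcm_set n : S n -> n %| lcm_set S.
Proof.
move=> Sn; rewrite /lcm_set fsbig_finite//= (big_rem n) /= ?dvdn_lcml//.
by rewrite in_fset_set// inE.
Qed.

Lemma lcm_set_dvdn k : (forall n, S n -> n %| k) -> lcm_set S %| k.
Proof.
move=> h; rewrite /lcm_set fsbig_finite//= big_seq.
apply: (big_ind (fun n => n %| k)) => [|a b ak bk|n]; first exact: dvd1n.
  by rewrite dvdn_lcm ak.
by rewrite in_fset_set// inE => /h.
Qed.

Lemma lcm_set_gt0 : (forall n, S n -> 0 < n) -> 0 < lcm_set S.
Proof.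
move=> h; rewrite /lcm_set fsbig_finite//= big_seq.
apply: (big_ind (fun n => 0 < n)) => // [a b a0 b0|n]; first by rewrite lcmn_gt0 a0.
by rewrite in_fset_set// inE => /h.
Qed.

End LcmSet.

Section Denominator.
Local Open Scope ring_scope.
Variables (R : realType) (N : nat) (L L' : language).
Variables (C : structure L -> Prop) (D : structure L' -> Prop).
Variables (r : nat) (I : interpretation C D r).
Local Notation member := {A : structure L' | D A}.
Hypothesis N_gt0 : (0 < N)%N.
Variables (U : universe_partition R N I) (Th : partition_choice R N I).

Lemma dvdn_reduced d e : (e %/ gcdn d e %| e)%N.
Proof. by apply/dvdnP; exists (gcdn d e); rewrite mulnC divnK// dvdn_gcdr. Qed.

Lemma label_le_max e lam : (e, lam) \in up_labels U ->
  (e <= \max_(l <- (up_labels U : seq (nat * R))) l.1)%N.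
Proof.
move=> h.
exact: (@leq_bigmax_seq _ _ xpredT (fun l : nat * R => l.1) _ h).
Qed.

Lemma finite_bounded (S : set nat) B : (forall n, S n -> (n <= B)%N) ->
  finite_set S.
Proof.
by move=> h; apply: sub_finite_set (finite_II B.+1) => n /h.
Qed.

Lemma EQ_finite : finite_set (EQ U).
Proof.
by apply: finite_bounded => e [_ [lam [_ /label_le_max h _]]]; exact: h.
Qed.

Definition visible_set : set nat :=
  [set n | exists d e : nat, occurs U Th d e /\ n = (e %/ gcdn d e)%N]%classic.

Lemma visible_finite : finite_set visible_set.
Proof.
apply: finite_bounded => n [d [e [[t [m [tau [phi [lam [mu [P [h _ _ _ _]]]]]]]] ->]]].
exact: leq_trans (leq_div _ _) (label_le_max h).
Qed.

Section Cell.
Variables (t : srt L') (m : nat) (tau : 'I_m -> srt L').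
Variables (phi : formula (ctx_ext tau t)).
Let Point := {A : member & env (sval A) tau}.
Let sizeA (x : Point) := str_size (sval (tag x)).
Let sizeM (x : Point) := str_size (host I (tag x)).

Definition joint_cell (l : label R) (P : {set cp_index (chosen Th phi)})
    (x : Point) : Prop :=
  sat (chi U l) (param I (tag x)) /\ profile (chosen Th phi) (tagged x) = P.

(* [A] is bounded in terms of its host, so that a host grows along with [A]. *)
Lemma large_host (cell : Point -> Prop) A :
  large sizeM cell A -> large sizeA cell A.
Proof.
move=> [Q hQ]; exists (#|srt L'| * Q ^ r)%N => x cx Qx; apply: hQ => //.
rewrite ltnNge; apply/negP => xQ; move: Qx; rewrite ltnNge => /negP[].
apply: leq_trans (str_size_le I (tag x)) _.
by rewrite leq_mul2l leq_exp2r ?(interp_arity I)// xQ orbT.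
Qed.

Lemma unbounded_host (cell : Point -> Prop) :
  unbounded sizeA cell -> unbounded sizeM cell.
Proof.
move=> uA Q; have : large sizeM cell (fun x => (Q < sizeM x)%N) by exists Q.
move=> /large_host[Q' h]; have [x cx Qx] := uA Q'.
by exists x => //; exact: h.
Qed.

Lemma profile_neq0 (A : member) (b : env (sval A) tau) :
  profile (chosen Th phi) b != finset.set0.
Proof.
have [v vb] := reps_ex I b.
have [|i [si _]] := @cp_unique _ _ _ _ _ _ _ _ _ _ _ _
  (chosen Th phi) A (fun k => tup_fun (v k)).
  by move=> k; exact: iso_class_X (vb k).
by apply/set0Pn; exists i; rewrite inE; apply/asboolP; exists (fun k => tup_fun (v k)).
Qed.

Variables (l : label R) (P : {set cp_index (chosen Th phi)}).
Hypothesis l_label : l \in up_labels U.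

Lemma joint_asymptotic i : i \in P ->
  asymptotic_to N sizeM (joint_cell l P) (fun x => nb_sol phi (tagged x))
    (cp_label i).
Proof.
move=> iP e e0; have [Q hQ] := cp_asymptotic i e0.
exists Q => x [_ xP] Qx; apply: hQ => //.
by move: iP; rewrite -xP inE => /asboolP.
Qed.

Hypothesis unb : unbounded sizeA (joint_cell l P).

Let FG := largeP sizeA (joint_cell l P).
Let cG := large_consistent unb.
Let host_oo (a : R) : large sizeA (joint_cell l P) (fun x => a < (sizeM x)%:R).
Proof. by apply: large_host; exact: large_oo. Qed.
Let size_oo (a : R) : large sizeA (joint_cell l P) (fun x => a < (sizeA x)%:R).
Proof. exact: large_oo. Qed.

Lemma joint_universe_rate :
  rate (large sizeA (joint_cell l P)) (fun x => (sizeM x)%:R)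
    (fun x => (sizeA x)%:R) (l.1%:R / N%:R) l.2.
Proof.
have /asymptotic_rate h : asymptotic_to N sizeM (joint_cell l P) sizeA l.
  move=> e e0; have [Q hQ] := up_asymptotic l_label e0.
  by exists Q => x [lx _]; exact: hQ.
by move=> e e0; apply: large_host (h e e0).
Qed.

Lemma joint_universe_label : (0 < l.1)%N /\ 0 < l.2.
Proof.
suff l0 : (0 < l.1)%N.
  split=> //; have [[_ ->]//|le] := up_valid l_label.
  by move: l0; rewrite le.
(* With exponent 0 the size of A would come within 1 of [l.2], yet it exceeds [l.2 + 1] far out in
   the cell. *)
rewrite lt0n; apply/negP => /eqP l0.
have := joint_universe_rate; rewrite l0 mul0r => h.
have [x [h1 h2]] := cG (ev_and FG (h 1 ltr01) (size_oo (l.2 + 1))).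
move: h1; rewrite powRr0 divr1 distrC => /ler_normlP[_].
by rewrite lerBlDl leNgt h2.
Qed.

(** Both labels describe the same counts on the same cell, which is unbounded in host size as well,
    so uniqueness of labels applies. *)
Lemma joint_labels_eq i j : i \in P -> j \in P -> cp_label i = cp_label j.
Proof.
move=> iP jP; apply: (label_unique N_gt0 (unbounded_host unb)
  (cp_valid i) (cp_valid j)); exact: joint_asymptotic.
Qed.

Lemma joint_rate i (d := (cp_label i).1) : i \in P -> 0 < (cp_label i).2 ->
  (d <= l.1)%N /\ exists2 mu : R, 0 < mu &
  rate (large sizeA (joint_cell l P)) (fun x => (sizeA x)%:R)
    (fun x => (nb_sol phi (tagged x))%:R) (d%:R / l.1%:R) mu.
Proof.
move=> iP mu0; have [e0 lam0] := joint_universe_label.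
have /asymptotic_rate h := joint_asymptotic iP.
have {}h : rate (large sizeA (joint_cell l P)) (fun x => (sizeM x)%:R)
    (fun x => (nb_sol phi (tagged x))%:R) (d%:R / N%:R) (cp_label i).2.
  by move=> e e_gt0; apply: large_host (h e e_gt0).
have eN : 0 < l.1%:R / N%:R :> R by rewrite divr_gt0 ?ltr0n.
have := rate_change FG host_oo eN lam0 h joint_universe_rate.
rewrite invf_div mulrA divfK ?pnatr_eq0 -?lt0n//.
set mu := (cp_label i).2 / _.
have mu_gt0 : 0 < mu by rewrite divr_gt0 ?powR_gt0.
move=> hr; split; last by exists mu.
(* The count is at most |A|, of exponent 1, which forces d / e <= 1. *)
have le1 : large sizeA (joint_cell l P)
    (fun x => (nb_sol phi (tagged x))%:R <= (sizeA x)%:R `^ 1 :> R).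
  exists 0%N => x _ _; rewrite powRr1// ler_nat.
  apply: leq_trans (nb_sol_le_sort _ _) _; exact: card_sort_le_size.
have := rate_le FG size_oo cG mu_gt0 le1 hr (rate_pow FG size_oo 1).
by rewrite ler_pdivrMr ?ltr0n// mul1r ler_nat.
Qed.

End Cell.

Lemma occurs_cell d e : occurs U Th d e ->
  exists (t : srt L') (m : nat) (tau : 'I_m -> srt L')
    (phi : formula (ctx_ext tau t)) (lam : R)
    (P : {set cp_index (chosen Th phi)}) (i : cp_index (chosen Th phi)),
  [/\ (e, lam) \in up_labels U, i \in P, (cp_label i).1 = d,
      0 < (cp_label i).2
    & unbounded (fun x => str_size (sval (tag x))) (joint_cell (e, lam) P)].
Proof.
move=> [t [m [tau [phi [lam [mu [P [h1 /set0Pn[i iP] h2 h3 h4]]]]]]]].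
exists t, m, tau, phi, lam, P, i; split; rewrite ?(h3 i iP)//.
move=> Q; have [A [b [cA pA QA]]] := h2 Q.
by exists (existT _ A b).
Qed.

Lemma cell_occurs (t : srt L') (m : nat) (tau : 'I_m -> srt L')
    (phi : formula (ctx_ext tau t)) (l : label R)
    (P : {set cp_index (chosen Th phi)}) (i : cp_index (chosen Th phi)) :
  l \in up_labels U -> i \in P -> 0 < (cp_label i).2 ->
  unbounded (fun x => str_size (sval (tag x))) (joint_cell l P) ->
  occurs U Th (cp_label i).1 l.1.
Proof.
move=> ll iP mu0 unb.
exists t, m, tau, phi, l.2, (cp_label i).2, P; split=> //.
- by case: (l) ll.
- by apply/set0Pn; exists i.
- by move=> Q; have [[A b] [cA pA] QA] := unb Q; exists A, b; split=> //;
    move: cA; case: (l).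
- by move=> j jP; rewrite (joint_labels_eq unb jP iP); case: (cp_label i).
Qed.

Lemma visible_dvd_EQ n : visible_set n -> exists2 e, EQ U e & (n %| e)%N.
Proof.
move=> [d [e [+ ->]]].
move=> /occurs_cell[t [m [tau [phi [lam [P [i [h1 h2 h3 h4 h5]]]]]]]].
have [e0 lam0] := joint_universe_label h1 h5.
exists e; last exact: dvdn_reduced.
split=> //; exists lam; split=> // Q.
by have [[A b] [cA _] QA] := h5 Q; exists A.
Qed.

Lemma Lvis_dvd_LQ : (Lvis U Th %| LQ U)%N.
Proof.
apply: (lcm_set_dvdn visible_finite) => n /visible_dvd_EQ[e eE ne].
exact: dvdn_trans ne (dvdn_lcm_set EQ_finite eE).
Qed.

Lemma Lvis_gt0 : (0 < Lvis U Th)%N.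
Proof.
apply: (lcm_set_gt0 visible_finite) => n /visible_dvd_EQ[e [e0 _]].
exact: dvdn_gt0.
Qed.

(** A bounded cell accepts any label, the label (0, 0) carries over, and exponent d / e becomes a
    fraction with denominator [Lvis] because its reduced denominator divides [Lvis]. *)
Lemma joint_target_label (t : srt L') (m : nat) (tau : 'I_m -> srt L')
    (phi : formula (ctx_ext tau t)) (l : label R) P :
  l \in up_labels U ->
  exists l' : label R, valid_label (Lvis U Th) l' /\
    asymptotic_to (Lvis U Th) (fun x => str_size (sval (tag x)))
      (joint_cell (phi := phi) l P) (fun x => nb_sol phi (tagged x)) l'.
Proof.
move=> ll.
set sizeA := fun x : {A : member & env (sval A) tau} => str_size (sval (tag x)).
have [unb|/asymptotic_bounded bc] := pselect (unbounded sizeA (joint_cell l P));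
  last by exists (0%N, 0); split; [right|exact: bc].
have /set0Pn[i iP] : P != finset.set0.
  by have [[A b] [_ /= <-] _] := unb 0%N; exact: profile_neq0.
have [[dN mu0]|i0] := cp_valid i; last first.
  exists (0%N, 0); split; first by right.
  (* At exponent 0 the normalising power is 1 for either size, so only the passage from large hosts
     to large A remains. *)
  have /asymptotic_rate := joint_asymptotic l iP.
  rewrite i0 mul0r => h; apply/asymptotic_rate; rewrite mul0r => e e0.
  have [Q hQ] := large_host (h e e0).
  by exists Q => x cx Qx; have := hQ x cx Qx; rewrite !powRr0.
have [de [mu mu_gt0 hr]] := joint_rate ll unb iP mu0.
have [e0 lam0] := joint_universe_label ll unb.
set d := (cp_label i).1 in de hr; set e := l.1 in de hr e0.
set h := Lvis U Th; have h0 : (0 < h)%N := Lvis_gt0.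
have nh : (e %/ gcdn d e %| h)%N.
  apply: (dvdn_lcm_set visible_finite).
  by exists d, e; split=> //; exact: (cell_occurs ll iP mu0 unb).
(* This is k / h = d / e in integers, k being the numerator of d / e over the denominator h; d <= e
   then yields k <= h. *)
have kE : (h %/ (e %/ gcdn d e) * (d %/ gcdn d e) * e = d * h)%N.
  transitivity (h %/ (e %/ gcdn d e) * (d %/ gcdn d e) *
                (e %/ gcdn d e * gcdn d e))%N.
    by rewrite (divnK (dvdn_gcdr d e)).
  by rewrite mulnACA (divnK nh) (divnK (dvdn_gcdl d e)) mulnC.
set k := (h %/ (e %/ gcdn d e) * (d %/ gcdn d e))%N in kE.
exists (k, mu); split.
  left; split=> //=.
  by rewrite -(leq_pmul2r e0) kE mulnC leq_mul2l de orbT.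
apply/asymptotic_rate => /=.
suff -> : k%:R / h%:R = d%:R / e%:R :> R by [].
apply/eqP; rewrite eqr_div ?pnatr_eq0 -?lt0n// -!natrM eqr_nat; exact/eqP.
Qed.

Lemma target_class : universe_descent U -> asymptotic_class R (Lvis U Th) D.
Proof.
move=> ud; split=> [|s m c phi]; first exact: Lvis_gt0.
pose labs : seq (nat * R) := up_labels U.
pose J : finType := (seq_sub labs * {set cp_index (chosen Th phi)})%type.
pose cell (j : J) (x : {A : member & env (sval A) c}) : bool :=
  sat (chi U (ssval j.1)) (param I (tag x)) &&
  (profile (chosen Th phi) (tagged x) == j.2).
pose sizeA (x : {A : member & env (sval A) c}) := str_size (sval (tag x)).
have lab_ex (j : J) : exists l' : label R, valid_label (Lvis U Th) l' /\
    asymptotic_to (Lvis U Th) sizeA (fun x => True /\ cell j x)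
      (fun x => nb_sol phi (tagged x)) l'.
  have [l' [v a]] := joint_target_label j.2 (ssvalP j.1).
  exists l'; split=> // e e0; have [Q hQ] := a e e0; exists Q => x [_ cx].
  by apply: hQ; move/andP: cx => [? /eqP].
pose lab j : nat * R := sval (cid (lab_ex j)).
have labP j := svalP (cid (lab_ex j)).
have cell_def (j : J) : definable (C := D) (fun A b => cell j (existT _ A b)).
  apply: definable_and.
    have [psi hpsi] := ud _ (ssvalP j.1).
    have [q hq] := formula_pull (c := of_void (srt L')) (c' := c)
      (t := of_void 'I_m) (fun v => match v with end) psi.
    exists q => A b; rewrite hq; apply/idP/idP => /=.
      move=> h; apply/hpsi; move: h; congr (is_true (sat _ _)).
      by apply: functional_extensionality_dep => -[].
    move=> /hpsi; congr (is_true (sat _ _)).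
    by apply: functional_extensionality_dep => -[].
  (* Definability is only assumed for nonempty profiles; no tuple has the empty one, so its cell is
     void. *)
  have [P0|Pn0] := eqVneq j.2 finset.set0.
    apply: definable_ext (definable_false _ _) => A b /=.
    by rewrite P0 (negbTE (profile_neq0 _ _)).
  have [psi hpsi] := chosen_definable Pn0.
  by exists psi => A b; apply/idP/eqP => /hpsi.
have dtheta (e : label R) : definable (C := D)
    (fun A b => merged_cell cell lab e (existT _ A b)).
  apply: definable_exists => j; apply: definable_and => //.
  exact: definable_const.
pose theta e := sval (cid (dtheta e)).
have thetaP e (A : member) (b : env (sval A) c) :
    sat (theta e) b = merged_cell cell lab e (existT _ A b).
  by rewrite /theta; case: cid => q /= ->.
exists (merged_labels lab), theta; split.
- by move=> e /merged_labelsP[j ->]; exact: (labP j).1.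
- move=> M DM b; pose A : member := exist _ M DM.
  have [|e [[e1 e2] eu]] := @merged_unique R _ J cell lab (existT _ A b).
    have [l0 [[l1 l2] lu]] := up_unique U A.
    exists (SeqSub (l1 : l0 \in labs), profile (chosen Th phi) (A := A) b).
    split; first by rewrite /cell /= l2 eqxx.
    move=> [l' P] /andP[/= lA /eqP <-]; congr pair; apply: val_inj => /=.
    by apply: lu; split=> //; exact: ssvalP.
  exists e; split; first by rewrite (thetaP e A).
  by move=> e'; rewrite (thetaP e' A); exact: eu.
- move=> e _ eps eps0.
  have [Q hQ] := merged_asymptotic e (fun j => (labP j).2) eps0.
  exists Q => -[M b] [DM sb] Qx.
  apply: (hQ (existT _ (exist _ M DM) b)) => //; split=> //.
  by rewrite -(thetaP e (exist _ M DM)).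
Qed.

(** A visible exponent d / e must equal the exponent j / k assigned by any k-dimensional description
    of the same counts, so e / gcd(d, e) divides k. *)
Lemma Lvis_dvd k : asymptotic_class R k D -> (Lvis U Th %| k)%N.
Proof.
move=> [k0 kD]; apply: (lcm_set_dvdn visible_finite) => n [d [e [+ ->]]].
move=> /occurs_cell[t [m [tau [phi [lam [P [i [h1 iP hd mu0 unb]]]]]]]].
have [de [mu mu_gt0 hr]] := joint_rate h1 unb iP mu0.
have [/= e0 _] := joint_universe_label h1 unb.
rewrite hd /= in de hr.
have [D' [theta [Dv Du Da]]] := kD t m tau phi.
pose sizeA (x : {A : member & env (sval A) tau}) := str_size (sval (tag x)).
pose cell l (x : {A : member & env (sval A) tau}) : Prop :=
  joint_cell (e, lam) P x /\ sat (theta l) (tagged x).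
(* The finitely many cells of the k-dimensional description cover the unbounded joint cell, so one
   of them meets it in an unbounded set. *)
have [l' lD unb'] : exists2 l', l' \in D' & unbounded sizeA (cell l').
  apply: contrapT => /forall2NP nunb.
  have bl l : exists Q, l \in D' -> forall x, cell l x -> (sizeA x <= Q)%N.
    by case: (nunb l) => [nl|/bounded_cell[Q hQ]]; [exists 0%N|exists Q].
  pose Q l := sval (cid (bl l)).
  have [x cx] := unb (\max_(l <- (D' : seq (nat * R))) Q l)%N.
  have [l [[lD sl] _]] := Du _ (svalP (tag x)) (tagged x).
  rewrite ltnNge => /negP[]; apply: leq_trans (@leq_bigmax_seq _ _ xpredT Q _ lD isT).
  exact: (svalP (cid (bl l)) lD).
have hr' : rate (large sizeA (cell l')) (fun x => (sizeA x)%:R)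
    (fun x => (nb_sol phi (tagged x))%:R) (d%:R / e%:R) mu.
  by move=> eps eps0; apply: large_sub (hr eps eps0) => x [].
have /asymptotic_rate ha : asymptotic_to k sizeA (cell l')
    (fun x => nb_sol phi (tagged x)) l'.
  move=> eps eps0; have [Q hQ] := Da _ lD eps eps0.
  exists Q => x [_ sx] Qx.
  apply: (hQ (existT _ (sval (tag x)) (tagged x))) => //.
  by split=> //; exact: svalP.
have FF := largeP sizeA (cell l').
have oo := @large_oo R _ sizeA (cell l').
have cF := large_consistent unb'.
case: (Dv _ lD) => [[_ mu'0]|l0]; last first.
  have [l1 l2] : l'.1 = 0%N /\ l'.2 = 0 by rewrite l0.
  rewrite l1 l2 mul0r in ha.
  case: (rate0_absurd FF oo cF _ mu_gt0 ha hr').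
  by rewrite divr_ge0.
(* Uniqueness of exponents gives d / e = l'.1 / k; clearing denominators and dividing by the gcd
   leaves a product to which the Gauss lemma applies. *)
have [+ _] := rate_unique FF oo cF mu_gt0 mu'0 hr' ha.
move/eqP; rewrite eqr_div ?pnatr_eq0 -?lt0n// -!natrM eqr_nat => /eqP dk.
have g0 : (0 < gcdn d e)%N by rewrite gcdn_gt0 e0 orbT.
have : (e %/ gcdn d e %| d %/ gcdn d e * k)%N.
  apply/dvdnP; exists l'.1; apply/eqP; rewrite -(eqn_pmul2r g0); apply/eqP.
  by rewrite mulnAC divnK ?dvdn_gcdl// dk -mulnA divnK// dvdn_gcdr.
rewrite Gauss_dvdr// /coprime.
by rewrite -(eqn_pmul2r g0) mul1n muln_gcdl !divnK ?dvdn_gcdl ?dvdn_gcdr// gcdnC.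
Qed.

Lemma Lvis_least : universe_descent U ->
  least_asymptotic_denominator R D (Lvis U Th).
Proof.
move=> ud; split; first exact: target_class.
by move=> k kD; apply: dvdn_leq (Lvis_dvd kD); case: kD.
Qed.

End Denominator.

Section Choices.
Variables (R : realType) (N : nat) (L L' : language).
Variables (C : structure L -> Prop) (D : structure L' -> Prop).
Variables (r : nat) (I : interpretation C D r).
Hypothesis C_class : asymptotic_class R N C.

Lemma partition_choice_ex : profile_descent R N I ->
  inhabited (partition_choice R N I).
Proof.
move=> pd; constructor.
apply: (@PartitionChoice _ _ _ _ _ _ _ _
  (fun t m tau phi => sval (cid (pd t m tau phi)))).
by move=> t m tau phi; case: cid.
Qed.

Lemma descent_universe (U : universe_partition R N I) :
  descent_hypothesis U -> universe_descent U.
Proof. by move=> [qr|[]//]; exact: reflecting_universe_descent. Qed.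

Lemma descent_profile (U : universe_partition R N I) :
  descent_hypothesis U -> profile_descent R N I.
Proof.
move=> [qr|[]//] t m tau phi.
have [Th] := counting_partition_ex I C_class phi.
by exists Th; exact: reflecting_profile_definable.
Qed.

End Choices.

Theorem proposition8p12 (R : realType) (L' : language)
    (D : structure L' -> Prop) :
  (forall (L : language) (N : nat) (C : structure L -> Prop) (r : nat)
     (I : interpretation C D r),
     asymptotic_class R N C ->
     inhabited (universe_partition R N I) /\
     forall U : universe_partition R N I,
       descent_hypothesis U ->
       inhabited (partition_choice R N I) /\
       forall Th : partition_choice R N I,
         (Lvis U Th %| LQ U)%N /\
         least_asymptotic_denominator R D (Lvis U Th)) /\
  (forall (L1 : language) (N1 : nat) (C1 : structure L1 -> Prop) (r1 : nat)
     (I1 : interpretation C1 D r1) (U1 : universe_partition R N1 I1)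
     (Th1 : partition_choice R N1 I1)
     (L2 : language) (N2 : nat) (C2 : structure L2 -> Prop) (r2 : nat)
     (I2 : interpretation C2 D r2) (U2 : universe_partition R N2 I2)
     (Th2 : partition_choice R N2 I2),
     asymptotic_class R N1 C1 -> descent_hypothesis U1 ->
     asymptotic_class R N2 C2 -> descent_hypothesis U2 ->
     Lvis U1 Th1 = Lvis U2 Th2).
Proof.
split=> [L N C r I C_class|].
  split=> [|U dU]; first exact: universe_partition_ex.
  split=> [|Th]; first exact: (partition_choice_ex (descent_profile C_class dU)).
  split; first exact: Lvis_dvd_LQ.
  exact: Lvis_least C_class.1 _ _ (descent_universe dU).
move=> L1 N1 C1 r1 I1 U1 Th1 L2 N2 C2 r2 I2 U2 Th2 C1_class d1 C2_class d2.
(* Leastness refers to [D] alone, so each of the two numbers bounds the other. *)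
have [k1 le1] := Lvis_least C1_class.1 Th1 (descent_universe d1).
have [k2 le2] := Lvis_least C2_class.1 Th2 (descent_universe d2).
by apply/eqP; rewrite eqn_leq le1// le2.
Qed.
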